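(* Let $(\mathfrak{A}, G, \Theta)$ be a C*-dynamical system, where $\mathfrak{A}$ is a nonzero separable unital C*-algebra and $G$ is a countable discrete amenable group. Then the following conditions are equivalent. (i) $(\mathfrak{A}, G, \Theta)$ is uniquely ergodic. (ii) There exist a left Følner sequence $(F_k)_{k=1}^\infty$ for $G$ and a linear functional $\phi : \mathfrak{A} \to \mathbb{C}$ such that for all $x \in \mathfrak{A}$, the sequence $(\operatorname{Avg}_{F_k} x)_{k=1}^\infty$ converges in norm to $\phi(x) 1 \in \mathbb{C}1$. (iii) There exist a left Følner sequence $(F_k)_{k=1}^\infty$ for $G$ and a linear functional $\phi : \mathfrak{A} \to \mathbb{C}$ such that for all $x \in \mathfrak{A}$, the sequence $(\operatorname{Avg}_{F_k} x)_{k=1}^\infty$ converges weakly to $\phi(x) 1 \in \mathbb{C}1$. (iv) There exists a state $\phi$ on $\mathfrak{A}$ such that for every right Følner sequence $(F_k)_{k=1}^\infty$ for $G$ and every $x \in \mathfrak{A}$, the sequence $(\operatorname{Avg}_{F_k} x)_{k=1}^\infty$ converges in norm to $\phi(x) 1 \in \mathbb{C}1$. (v) There exists a state $\phi$ on $\mathfrak{A}$ such that for every right Følner sequence $(F_k)_{k=1}^\infty$ for $G$ and every $x \in \mathfrak{A}$, the sequence $(\operatorname{Avg}_{F_k} x)_{k=1}^\infty$ converges weakly to $\phi(x) 1 \in \mathbb{C}1$.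
   Context: A C*-dynamical system $(\mathfrak{A}, G, \Theta)$ consists of a unital C*-algebra $\mathfrak{A}$, a topological group $G$, and a group homomorphism $\Theta : G \to \operatorname{Aut}(\mathfrak{A})$, $g \mapsto \Theta_g$, into the *-automorphisms of $\mathfrak{A}$ which is continuous for the point-norm topology (automatic for discrete $G$). A state $\phi$ on $\mathfrak{A}$ is $\Theta$-invariant if $\phi \circ \Theta_g = \phi$ for all $g \in G$; $\mathcal{S}^G$ denotes the set of $\Theta$-invariant states. The system is uniquely ergodic if $\mathcal{S}^G$ is a singleton. For a nonempty finite set $F \subseteq G$, $\operatorname{Avg}_F x := \frac{1}{|F|} \sum_{g \in F} \Theta_g x$. A left (resp. right) Følner sequence for $G$ is a sequence $(F_k)_{k=1}^\infty$ of nonempty finite subsets of $G$ such that $|gF_k \Delta F_k|/|F_k| \to 0$ (resp. $|F_k g \Delta F_k|/|F_k| \to 0$) as $k \to \infty$ for every $g \in G$. A net $(x_i)_i$ in $\mathfrak{A}$ converges weakly to $x$ if $\psi(x_i) \to \psi(x)$ for every state $\psi$ on $\mathfrak{A}$. *)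

(* Defs.v *)
From HB Require Import structures.
From mathcomp Require Import all_boot all_order all_algebra finmap.
From mathcomp Require Import complex.
From mathcomp Require Import all_classical all_reals all_analysis.

Set Implicit Arguments.
Unset Strict Implicit.
Unset Printing Implicit Defensive.

Import Order.TTheory GRing.Theory Num.Theory.
Import numFieldNormedType.Exports.

Local Open Scope classical_set_scope.
Local Open Scope complex_scope.
Local Open Scope ring_scope.

(* Unital C*-algebras over the complex numbers R[i]. The norm is a separate
   operation because MathComp's hierarchy has no join of rings and normed
   modules other than numDomainType. An algType has 1 != 0, so these algebras
   are nonzero. *)
HB.mixin Record isCStarAlgebra (R : realType) A of GRing.Algebra R[i] A := {
  star : A -> A;
  cnorm : A -> R;
  starD : forall a b : A, star (a + b) = star a + star b;
  starZ : forall (c : R[i]) (a : A), star (c *: a) = c^* *: star a;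
  starM : forall a b : A, star (a * b) = star b * star a;
  starK : forall a : A, star (star a) = a;
  cnorm_le_add : forall a b : A, cnorm (a + b) <= cnorm a + cnorm b;
  cnormZ : forall (c : R[i]) (a : A),
    cnorm (c *: a) = ComplexField.Normc.normc c * cnorm a;
  cnorm_eq0 : forall a : A, cnorm a = 0 -> a = 0;
  cnorm_complete : forall u : nat -> A,
    (forall e : R, 0 < e -> exists N : nat, forall m n : nat,
       (N <= m)%N -> (N <= n)%N -> cnorm (u m - u n) < e) ->
    exists a : A, (fun n => cnorm (u n - a)) @ \oo --> (0 : R);
  cnorm_le_mul : forall a b : A, cnorm (a * b) <= cnorm a * cnorm b;
  cnorm_star_mul : forall a : A, cnorm (star a * a) = cnorm a ^+ 2
}.

#[short(type="cstarAlgType")]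
HB.structure Definition CStarAlgebra (R : realType) :=
  {A of GRing.Algebra R[i] A & isCStarAlgebra R A}.

Definition separable (R : realType) (A : cstarAlgType R) : Prop :=
  exists2 D : set A, countable D &
    forall (a : A) (e : R), 0 < e -> exists2 d, D d & cnorm (a - d) < e.

Definition norm_converges (R : realType) (A : cstarAlgType R)
    (u : nat -> A) (a : A) : Prop :=
  (fun k => cnorm (u k - a)) @ \oo --> (0 : R).

Section States.
Context {R : realType} {A : cstarAlgType R}.

Definition linear_functional (phi : A -> R[i]) : Prop := scalar phi.

Definition state (phi : A -> R[i]) : Prop :=
  [/\ linear_functional phi,
      forall a : A, 0 <= phi (star a * a)
    & phi 1 = 1].

Definition weakly_converges (u : nat -> A) (a : A) : Prop :=
  forall psi : A -> R[i], state psi ->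
    (fun k => psi (u k) : R[i]^o) @ \oo --> (psi a : R[i]^o).

End States.

Record star_automorphism (R : realType) (A : cstarAlgType R) := StarAutomorphism {
  star_aut_fun :> {lrmorphism A -> A};
  star_aut_bij : bijective star_aut_fun;
  star_aut_star : forall a : A, star_aut_fun (star a) = star (star_aut_fun a)
}.

(* The acting group is discrete, so point-norm continuity is vacuous. *)
Record cstar_system (R : realType) (A : cstarAlgType R) (G : groupType) :=
  CStarSystem {
    action :> G -> star_automorphism A;
    actionM : forall (g h : G) (a : A), action (g * h)%g a = action g (action h a)
  }.

Section Systems.
Context {R : realType} {A : cstarAlgType R} {G : groupType}.
Variable Theta : cstar_system A G.

Definition invariant_states : set (A -> R[i]) :=
  [set phi | state phi /\ forall g : G, phi \o Theta g = phi].

Definition uniquely_ergodic : Prop :=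
  exists phi : A -> R[i], invariant_states = [set phi].

Definition Avg (F : {fset G}) (x : A) : A :=
  (#|` F|%:R)^-1 *: \sum_(g <- F) Theta g x.

End Systems.

Section Amenability.
Variable G : groupType.

Definition left_translate (g : G) (F : {fset G}) : {fset G} :=
  [fset (g * h)%g | h in F]%fset.

Definition right_translate (F : {fset G}) (g : G) : {fset G} :=
  [fset (h * g)%g | h in F]%fset.

Definition fsymdiff (E F : {fset G}) : {fset G} :=
  ((E `\` F) `|` (F `\` E))%fset.

Variable R : realType.

Definition left_Folner (F : nat -> {fset G}) : Prop :=
  (forall k, F k != fset0) /\
  forall g : G,
    (fun k => #|` fsymdiff (left_translate g (F k)) (F k)|%:R / #|` F k|%:R : R)
      @ \oo --> (0 : R).

Definition right_Folner (F : nat -> {fset G}) : Prop :=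
  (forall k, F k != fset0) /\
  forall g : G,
    (fun k => #|` fsymdiff (right_translate (F k) g) (F k)|%:R / #|` F k|%:R : R)
      @ \oo --> (0 : R).

(* Only the values of m on bounded functions are constrained. *)
Record left_invariant_mean (m : (G -> R) -> R) : Prop := LeftInvariantMean {
  mean_linear : forall (c : R) (f h : G -> R), bounded_fun f -> bounded_fun h ->
    m (fun x => c * f x + h x) = c * m f + m h;
  mean_ge0 : forall f : G -> R, bounded_fun f -> (forall x, 0 <= f x) -> 0 <= m f;
  mean_1 : m (fun=> 1) = 1;
  mean_invariant : forall (g : G) (f : G -> R), bounded_fun f ->
    m (fun x => f (g * x)%g) = m f
}.

Definition amenable : Prop := exists m, left_invariant_mean m.

End Amenability.

(* Main.v *)
(** A right Folner sequence satisfies [Avg_F (Theta_g x - x) -> 0], so that the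
    asymptotic upper bound [q x] of the self-adjoint part of [Avg_(F k) x] is a
    sublinear functional, and the linear functionals below it are the real
    parts of invariant states; by Hahn--Banach, for each [x] one of these,
    [psi], has [Re (psi x) = q x]. If the invariant state [phi] is unique,
    [q x = Re (phi x)] for [x] and [- x] traps the averages of a self-adjoint
    [x] between [phi x - e] and [phi x + e], whence norm convergence.
    In the other direction a weak limit of averages determines every invariant
    state, and invariant states exist by the same argument.

    Left and right conditions are reconciled by a two-sided Folner sequence,
    obtained from a bi-invariant mean by duality (Day, Namioka). Order and norm
    of the C*-algebra are related without spectral theory: the positive cone is
    [{h | exists t > 0, ||t - h|| <= t}], square roots come from iterating
    [b |-> (x + b^2) / 2], and [a^* a >= 0] is the Kelley--Vaught theorem. *)

Require Import Defs.
From HB Require Import structures.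
From mathcomp Require Import all_boot all_order all_algebra finmap.
From mathcomp Require Import complex.
From mathcomp Require Import all_classical all_reals all_analysis.
From mathcomp Require Import ring lra.

Set Implicit Arguments.
Unset Strict Implicit.
Unset Printing Implicit Defensive.

Import Order.TTheory GRing.Theory Num.Theory numFieldNormedType.Exports.

Local Open Scope classical_set_scope.
Local Open Scope complex_scope.
Local Open Scope ring_scope.

(** * The norm of a C*-algebra *)

Section CStarNorm.
Context {R : realType} {A : cstarAlgType R}.
Implicit Types (a b h u v : A) (r s t : R).

Lemma normc_real r : ComplexField.Normc.normc r%:C = `|r|.
Proof. by rewrite /= expr0n addr0 sqrtr_sqr. Qed.

Lemma cnormZr r a : cnorm (r%:C *: a) = `|r| * cnorm a.
Proof. by rewrite cnormZ normc_real. Qed.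

Lemma cnormZi a : cnorm ('i%C *: a) = cnorm a.
Proof. by rewrite cnormZ /= expr0n add0r expr1n sqrtr1 mul1r. Qed.

Lemma starZr r a : star (r%:C *: a) = r%:C *: star a.
Proof. by rewrite starZ; congr (_ *: _); exact: conjc_real. Qed.

Lemma starZi a : star ('i%C *: a) = - ('i%C *: star a).
Proof.
rewrite starZ -scaleNr; congr (_ *: _).
by apply/eqP; rewrite eq_complex /= oppr0 !eqxx.
Qed.

Lemma star0 : star 0 = 0 :> A.
Proof. by have := starZr 0 0; rewrite !scale0r. Qed.

Lemma starN a : star (- a) = - star a.
Proof. by apply: (addrI (star a)); rewrite -starD !subrr star0. Qed.

Lemma starB a b : star (a - b) = star a - star b.
Proof. by rewrite starD starN. Qed.

Lemma star1 : star 1 = 1 :> A.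
Proof. by have := starM (star 1) (1 : A); rewrite mulr1 starK mulr1. Qed.

Lemma star_real r : star (r%:C%:A : A) = r%:C%:A.
Proof. by rewrite starZr star1. Qed.

Lemma cnorm0 : cnorm (0 : A) = 0.
Proof. by have := cnormZr 0 (0 : A); rewrite scale0r normr0 mul0r. Qed.

Lemma cnormN a : cnorm (- a) = cnorm a.
Proof.
by have := cnormZr (-1) a; rewrite rmorphN rmorph1 scaleN1r normrN1 mul1r.
Qed.

Lemma cnormB a b : cnorm (a - b) = cnorm (b - a).
Proof. by rewrite -cnormN opprB. Qed.

Lemma cnorm_ge0 a : 0 <= cnorm a.
Proof.
by have := cnorm_le_add a (- a); rewrite subrr cnorm0 cnormN -mulr2n pmulrn_lge0.
Qed.

(** In [||b||^2 = ||star b * b|| <= ||star b|| ||b||] one may divide by [||b||]; taking [a] and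
    [star a] for [b] gives both inequalities. *)
Lemma cnorm_star a : cnorm (star a) = cnorm a.
Proof.
suff le_star b : cnorm b <= cnorm (star b).
  by apply/eqP; rewrite eq_le le_star -{2}[a]starK le_star.
have := cnorm_le_mul (star b) b; rewrite cnorm_star_mul expr2.
have := cnorm_ge0 b; rewrite le_eqVlt => /predU1P[<-|b0].
  by rewrite cnorm_ge0.
by rewrite ler_pM2r.
Qed.

Lemma cnorm_mul_star a : cnorm (a * star a) = cnorm a ^+ 2.
Proof. by rewrite -{1}[a]starK cnorm_star_mul cnorm_star. Qed.

Lemma cnorm_sq h : star h = h -> cnorm (h * h) = cnorm h ^+ 2.
Proof. by move=> hsa; rewrite -{1}hsa cnorm_star_mul. Qed.

(** The C*-identity gives [||1||^2 = ||1||], and [||1|| = 0] is excluded by [1 != 0]. *)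
Lemma cnorm1 : cnorm (1 : A) = 1.
Proof.
have := cnorm_sq star1; rewrite mulr1 => /eqP; rewrite expr2.
rewrite -{1}[cnorm 1]mulr1 eq_sym -subr_eq0 -mulrBr mulf_eq0 subr_eq0.
case/orP => /eqP // /cnorm_eq0 /eqP; by rewrite oner_eq0.
Qed.

Lemma cnorm_real r : cnorm (r%:C%:A : A) = `|r|.
Proof. by rewrite cnormZr cnorm1 mulr1. Qed.

Lemma cnorm_sum (I : Type) (s : seq I) (F : I -> A) :
  cnorm (\sum_(i <- s) F i) <= \sum_(i <- s) cnorm (F i).
Proof.
elim/big_rec2: _ => [|i x y _ le_yx]; first by rewrite cnorm0.
by rewrite (le_trans (cnorm_le_add _ _)) ?lerD2l.
Qed.

Lemma cnorm_lim_le (u : nat -> A) a b r : norm_converges u a ->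
  (\forall n \near \oo, cnorm (u n - b) <= r) -> cnorm (a - b) <= r.
Proof.
move=> ua ub; apply/ler_addgt0Pr => e e0.
have /cvgrPdist_lt/(_ e e0) ua' := ua.
near \oo => n.
have := cnorm_le_add (a - u n) (u n - b); rewrite addrA subrK => /le_trans; apply.
rewrite addrC lerD//; first by near: n.
rewrite cnormB; have : `|0 - cnorm (u n - a)| < e by near: n.
by rewrite sub0r normrN ger0_norm ?cnorm_ge0// => /ltW.
Unshelve.
all: by end_near.
Qed.

End CStarNorm.

Section NormLimits.
Context {R : realType} {A : cstarAlgType R}.
Implicit Types (a b : A) (u v : nat -> A).

Lemma norm_converges_le u a (g : nat -> R) : g @ \oo --> (0 : R) ->
  (forall n, cnorm (u n - a) <= g n) -> norm_converges u a.
Proof.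
move=> g0 ug; apply: (@squeeze_cvgr _ _ _ _ (fun=> 0) g) => //.
- by near=> n; rewrite cnorm_ge0 ug.
- exact: cvg_cst.
Unshelve.
all: by end_near.
Qed.

Lemma norm_converges_cst a : norm_converges (fun=> a) a.
Proof.
apply: (norm_converges_le (g := fun=> 0)) => [|n]; first exact: cvg_cst.
by rewrite subrr cnorm0.
Qed.

Lemma norm_converges_unique u a b :
  norm_converges u a -> norm_converges u b -> a = b.
Proof.
move=> ua ub; apply/eqP; rewrite -subr_eq0; apply/eqP/cnorm_eq0/eqP.
rewrite eq_le cnorm_ge0 andbT; apply/ler_addgt0Pr => e e0; rewrite add0r.
apply: (cnorm_lim_le ua); have /cvgrPdist_lt/(_ e e0) := ub.
apply: filterS => n; rewrite sub0r normrN ger0_norm ?cnorm_ge0//.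
exact: ltW.
Qed.

Lemma norm_convergesD u v a b : norm_converges u a -> norm_converges v b ->
  norm_converges (fun n => u n + v n) (a + b).
Proof.
move=> ua vb; apply: norm_converges_le (_ : _ @ _ --> 0) _.
  by have := cvgD ua vb; rewrite addr0; apply.
by move=> n /=; rewrite opprD addrACA cnorm_le_add.
Qed.

Lemma norm_convergesZ (c : R[i]) u a : norm_converges u a ->
  norm_converges (fun n => c *: u n) (c *: a).
Proof.
move=> ua; apply: (norm_converges_le
  (g := fun n => ComplexField.Normc.normc c * cnorm (u n - a))).
  by rewrite -[X in _ --> X](mulr0 (ComplexField.Normc.normc c)); apply: cvgMr.
by move=> n; rewrite -scalerBr cnormZ.
Qed.

Lemma norm_converges_star u a : norm_converges u a ->
  norm_converges (fun n => star (u n)) (star a).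
Proof.
by move=> ua; apply: norm_converges_le ua _ => n; rewrite -starB cnorm_star.
Qed.

Lemma norm_convergesM u v a b : norm_converges u a -> norm_converges v b ->
  norm_converges (fun n => u n * v n) (a * b).
Proof.
move=> ua vb; apply: (norm_converges_le (g := fun n =>
  cnorm (u n - a) * cnorm (v n - b) + cnorm a * cnorm (v n - b)
  + cnorm (u n - a) * cnorm b)).
  rewrite [X in _ --> X](_ : 0 = 0 * 0 + cnorm a * 0 + 0 * cnorm b); last by ring.
  apply: cvgD; first apply: cvgD.
  - exact: cvgM.
  - exact: cvgMr.
  - exact: cvgMl.
move=> n; have -> : u n * v n - a * b =
    (u n - a) * (v n - b) + a * (v n - b) + (u n - a) * b.
  by rewrite -mulrDl subrK mulrBr mulrBl addrA subrK.
by rewrite (le_trans (cnorm_le_add _ _))// lerD ?cnorm_le_mul//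
  (le_trans (cnorm_le_add _ _))// lerD ?cnorm_le_mul.
Qed.

Lemma norm_converges_shift u a : norm_converges u a ->
  norm_converges (fun n => u n.+1) a.
Proof. by move=> ua; rewrite /norm_converges (cvg_shiftS (fun n => cnorm (u n - a))). Qed.

End NormLimits.

(** * Square roots by iteration *)

Section SquareRoot.
Context {R : realType} {A : cstarAlgType R}.
Implicit Types (a b h x y : A) (r s t : R).

(* The coefficients of [1 - sqrt (1 - x)] are nonnegative and sum to 1, so the
   scalar iterates at 1 dominate the differences of the iterates at [x]. *)
Fixpoint sqrt_iter x n : A :=
  if n is m.+1 then 2^-1%:C *: (x + sqrt_iter x m * sqrt_iter x m) else 0.

Fixpoint sqrt_major n : R :=
  if n is m.+1 then 2^-1 * (1 + sqrt_major m ^+ 2) else 0.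

Lemma sqrt_major_itv n : 0 <= sqrt_major n <= 1.
Proof. by elim: n => [|n /andP[t0 t1]] /=; [lra|nra]. Qed.

Lemma sqrt_majorS n : sqrt_major n <= sqrt_major n.+1.
Proof.
have /andP[t0 t1] := sqrt_major_itv n.
by have := sqr_ge0 (sqrt_major n - 1); rewrite /=; lra.
Qed.

Lemma sqrt_major_cauchy (e : R) : 0 < e -> exists N : nat,
  forall m n, (N <= n <= m)%N -> sqrt_major m - sqrt_major n < e.
Proof.
move=> e0; have nd : nondecreasing_seq sqrt_major.
  by apply/nondecreasing_seqP => n; exact: sqrt_majorS.
have : cvgn sqrt_major.
  apply: nondecreasing_is_cvgn => //; exists 1 => _ [n _ <-].
  by have /andP[] := sqrt_major_itv n.
move=> cv; have ubl n : sqrt_major n <= limn sqrt_major.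
  exact: nondecreasing_cvgn_le.
have /cvgrPdist_lt/(_ e e0)[N _ HN] := cv.
exists N => m n /andP[Nn _].
have := HN n Nn; rewrite /= ger0_norm ?subr_ge0//; have := ubl m; lra.
Qed.

Lemma cnorm_sqrt_iter x n : cnorm x <= 1 ->
  cnorm (sqrt_iter x n) <= sqrt_major n.
Proof.
move=> x1; elim: n => [|n IH] /=; first by rewrite cnorm0.
rewrite cnormZr ger0_norm ?invr_ge0// ler_pM2l ?invr_gt0//.
rewrite (le_trans (cnorm_le_add _ _))// lerD// (le_trans (cnorm_le_mul _ _))//.
by rewrite expr2 ler_pM ?cnorm_ge0.
Qed.

(** The identity [b^2 - c^2 = b (b - c) + (b - c) c] is estimated term by term, in parallel with its
    scalar analogue for the majorants. *)
Lemma cnorm_sqrt_iterB x n m : cnorm x <= 1 -> (n <= m)%N ->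
  cnorm (sqrt_iter x m - sqrt_iter x n) <= sqrt_major m - sqrt_major n.
Proof.
move=> x1; elim: n m => [m _|n IH [//|m] nm].
  by rewrite !subr0 cnorm_sqrt_iter.
rewrite /= -scalerBr cnormZr ger0_norm ?invr_ge0//.
rewrite -mulrBr ler_pM2l ?invr_gt0// !opprD !addrA.
rewrite [x + _]addrC [1 + _]addrC !addrK.
set b := sqrt_iter x m; set c := sqrt_iter x n.
have -> : b * b - c * c = b * (b - c) + (b - c) * c.
  by rewrite mulrBr mulrBl addrA subrK.
rewrite subr_sqr [leRHS]mulrDr.
rewrite (le_trans (cnorm_le_add _ _))// lerD//.
  rewrite (le_trans (cnorm_le_mul _ _))// mulrC.
  by rewrite ler_pM ?cnorm_ge0 ?IH ?cnorm_sqrt_iter.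
rewrite (le_trans (cnorm_le_mul _ _))//.
by rewrite ler_pM ?cnorm_ge0 ?IH ?cnorm_sqrt_iter.
Qed.

(** In the limit the recursion reads [2 b = x + b^2], that is [(1 - b)^2 = 1 - x]. The iterates are
    polynomials in [x], so [b] commutes with whatever commutes with [x]. *)
Lemma sqrt_1B x : star x = x -> cnorm x <= 1 -> exists b : A,
  [/\ star b = b, cnorm b <= 1, (1 - b) * (1 - b) = 1 - x
    & forall y, GRing.comm y x -> GRing.comm y b].
Proof.
move=> xsa x1; have [b ub] : exists b, norm_converges (sqrt_iter x) b.
  apply: cnorm_complete => e /sqrt_major_cauchy[N HN]; exists N => m n Nm Nn.
  wlog nm : m n Nm Nn / (n <= m)%N.
    move=> H; case: (leqP n m) => [|/ltnW] nm; first exact: H.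
    by rewrite cnormB; exact: H.
  by rewrite (le_lt_trans (cnorm_sqrt_iterB x1 nm))// HN// Nn.
have bE : b = 2^-1%:C *: (x + b * b).
  apply: (norm_converges_unique (norm_converges_shift ub)).
  apply/norm_convergesZ/norm_convergesD; first exact: norm_converges_cst.
  exact: norm_convergesM.
exists b; split.
- apply: norm_converges_unique (norm_converges_star ub) _.
  rewrite (_ : (fun n => _) = sqrt_iter x)//; apply/funext.
  by elim=> [|n IH] /=; rewrite ?star0// starZr starD starM IH xsa.
- rewrite -[b]subr0; apply: (cnorm_lim_le ub); near=> n.
  rewrite subr0 (le_trans (cnorm_sqrt_iter _ x1))//.
  by have /andP[] := sqrt_major_itv n.
- have : b + b = x + b * b.
    rewrite {1 2}bE -scalerDl -rmorphD (_ : 2^-1 + 2^-1 = 1) ?scale1r//.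
    by field.
  rewrite mulrBr mulr1 mulrBl mul1r => H.
  by rewrite -addrA -opprD addrA H addrK.
- move=> y yx; rewrite /GRing.comm.
  apply: (norm_converges_unique (u := fun n => y * sqrt_iter x n)).
    by apply: norm_convergesM => //; exact: norm_converges_cst.
  rewrite (_ : (fun n => _) = fun n => sqrt_iter x n * y).
    by apply: norm_convergesM => //; exact: norm_converges_cst.
  apply/funext; elim=> [|n IH] /=; first by rewrite mulr0 mul0r.
  rewrite -scalerAl -scalerAr; congr (_ *: _).
  by rewrite mulrDr mulrDl yx mulrA IH -mulrA IH mulrA.
Unshelve.
all: by end_near.
Qed.

End SquareRoot.

(** * The positive cone *)

Section Positivity.
Context {R : realType} {A : cstarAlgType R}.
Implicit Types (a b c h u v w x y z : A) (r s t : R).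

Local Notation "r %:S" := (r%:C%:A : A) (at level 2, format "r %:S").

Lemma realSD r s : (r + s)%:S = r%:S + s%:S.
Proof. by rewrite rmorphD scalerDl. Qed.

Lemma realSZ r s : r%:C *: s%:S = (r * s)%:S.
Proof. by rewrite scalerA -rmorphM. Qed.

Lemma mul_realS r a : r%:S * a = r%:C *: a.
Proof. by rewrite -scalerAl mul1r. Qed.

Lemma mulr_realS r a : a * r%:S = r%:C *: a.
Proof. by rewrite -scalerAr mulr1. Qed.

Lemma comm_realS a r : GRing.comm a r%:S.
Proof. by rewrite /GRing.comm mul_realS mulr_realS. Qed.

(** For self-adjoint [h] the norm condition says that the spectrum lies in [[0, 2t]]. In this form
    the triangle inequality alone makes sums positive. *)
Definition positive h : Prop :=
  star h = h /\ exists2 t, 0 < t & cnorm (t%:S - h) <= t.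

Lemma positive_sa h : positive h -> star h = h.
Proof. by case. Qed.

(** This is [sqrt_1B] for [x / t], scaled by [sqrt t]. The norm bound certifies that [c] is
    positive, with witness [sqrt t]. *)
Lemma sqrt_realB x t : star x = x -> 0 < t -> cnorm x <= t -> exists c : A,
  [/\ star c = c, cnorm ((Num.sqrt t)%:S - c) <= Num.sqrt t, c * c = t%:S - x
    & forall y, GRing.comm y x -> GRing.comm y c].
Proof.
move=> xsa t0 xt.
have [||b [bsa b1 bE bC]] := @sqrt_1B R A (t^-1%:C *: x).
- by rewrite starZr xsa.
- by rewrite cnormZr gtr0_norm ?invr_gt0// ler_pdivrMl// mulr1.
exists ((Num.sqrt t)%:C *: (1 - b)); split.
- by rewrite starZr starB star1 bsa.
- rewrite -scalerBr opprB addrC subrK cnormZr ger0_norm ?sqrtr_ge0//.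
  by rewrite ler_piMr// sqrtr_ge0.
- rewrite -scalerAl -scalerAr bE scalerA -rmorphM -expr2 sqr_sqrtr ?ltW//.
  by rewrite scalerBr scalerA -rmorphM divff ?gt_eqF// scale1r.
- move=> y yx; rewrite /GRing.comm -scalerAl -scalerAr; congr (_ *: _).
  rewrite mulrBr mulrBl mul1r mulr1 bC//.
  by rewrite /GRing.comm -scalerAl -scalerAr yx.
Qed.

Lemma positive_sqrt h : positive h -> exists c : A,
  [/\ positive c, c * c = h & forall y, GRing.comm y h -> GRing.comm y c].
Proof.
move=> [hsa [t t0 ht]].
have [||c [csa ct cE cC]] := @sqrt_realB (t%:S - h) t _ t0.
- by rewrite starB star_real hsa.
- by [].
exists c; split.
- by split=> //; exists (Num.sqrt t); rewrite ?sqrtr_gt0.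
- by rewrite cE opprB addrC subrK.
- move=> y yh; apply: cC.
  by rewrite /GRing.comm mulrBr mulrBl mul_realS mulr_realS yh.
Qed.

Lemma positive_real r : 0 <= r -> positive r%:S.
Proof.
move=> r0; split; first exact: star_real.
(* The witness must be strictly positive, also for [r = 0]. *)
exists (r + 1); first lra.
by rewrite -scalerBl -rmorphB cnorm_real [r + 1]addrC addrK ger0_norm; lra.
Qed.

Lemma positive0 : positive 0.
Proof. by have := positive_real (lexx 0); rewrite scale0r. Qed.

Lemma positiveD u v : positive u -> positive v -> positive (u + v).
Proof.
move=> [usa [s s0 us]] [vsa [t t0 vt]]; split; first by rewrite starD usa vsa.
exists (s + t); first exact: addr_gt0.
by rewrite realSD opprD addrACA (le_trans (cnorm_le_add _ _))// lerD.
Qed.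

Lemma positiveZ r u : 0 <= r -> positive u -> positive (r%:C *: u).
Proof.
rewrite le_eqVlt => /predU1P[<- _|r0 [usa [s s0 us]]].
  by rewrite scale0r; exact: positive0.
split; first by rewrite starZr usa.
exists (r * s); first exact: mulr_gt0.
by rewrite -realSZ -scalerBr cnormZr gtr0_norm// ler_pM2l.
Qed.

Lemma positive_realB h t : star h = h -> cnorm h <= t -> positive (t%:S - h).
Proof.
move=> hsa ht; have := le_trans (cnorm_ge0 h) ht.
rewrite le_eqVlt => /predU1P[t0|t0].
  have /cnorm_eq0 -> : cnorm h = 0.
    by apply/eqP; rewrite eq_le cnorm_ge0 t0 ht.
  by rewrite -t0 scale0r subr0; exact: positive0.
split; first by rewrite starB star_real hsa.
by exists t => //; rewrite opprB addrC subrK.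
Qed.

Lemma positive_realD h t : star h = h -> cnorm h <= t -> positive (t%:S + h).
Proof.
move=> hsa ht; rewrite -[h]opprK; apply: positive_realB.
  by rewrite starN hsa.
by rewrite cnormN.
Qed.

(* The element [b + i c] is a multiple of a unitary, and its square has real
   part [b^2 - c^2]. *)
Lemma cnorm_sqB b c r : star b = b -> star c = c -> GRing.comm b c ->
  0 <= r -> b * b + c * c = r%:S -> cnorm (b * b - c * c) <= r.
Proof.
move=> bsa csa bc r0 bcr; set d := 'i%C *: c.
have dd : d * d = - (c * c).
  by rewrite -scalerAl -scalerAr scalerA -expr2 sqr_i scaleN1r.
have bd : b * d = d * b by rewrite -scalerAl -scalerAr bc.
have su : star (b + d) = b - d by rewrite starD bsa starZi csa.
have nu : cnorm (b + d) ^+ 2 = r.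
  rewrite -cnorm_star_mul su mulrBl !mulrDr bd dd.
  by rewrite opprB addrA addrAC addrK bcr cnorm_real ger0_norm.
have E : (b + d) * (b + d) + (b - d) * (b - d) = 2%:C *: (b * b - c * c).
  rewrite !(mulrDl, mulrDr, mulNr, mulrN) opprK dd bd.
  rewrite rmorphD rmorph1 scalerDl scale1r.
  set p := b * b; set q := d * b; set e := c * c.
  rewrite (addrC q) [- q - e]addrC [p + q + _]addrACA [p - q + _]addrACA [LHS]addrACA.
  by rewrite -opprD subrr addr0.
have := cnorm_le_add ((b + d) * (b + d)) ((b - d) * (b - d)).
rewrite E cnormZr ger0_norm// => H.
have nd : cnorm (b - d) = cnorm (b + d) by rewrite -su cnorm_star.
rewrite expr2 in nu.
have := cnorm_le_mul (b + d) (b + d); have := cnorm_le_mul (b - d) (b - d).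
by rewrite nd nu; lra.
Qed.

(** With [t = ||b^2|| + 1] and [c^2 = t - b^2], [cnorm_sqB] bounds [||2 b^2 - t||] by [t]; halved,
    this is positivity with witness [t / 2]. *)
Lemma positive_sq b : star b = b -> positive (b * b).
Proof.
move=> bsa; have bbsa : star (b * b) = b * b by rewrite starM bsa.
have t0 : 0 < cnorm (b * b) + 1 by rewrite ltr_wpDl ?cnorm_ge0.
set t := _ + 1 in t0; have [|c [csa _ cE cC]] := @sqrt_realB (b * b) t bbsa t0.
  by rewrite /t; lra.
split=> //; exists (t / 2); first by rewrite divr_gt0.
have : cnorm (b * b - c * c) <= t.
  apply: cnorm_sqB => //; last by rewrite cE addrC subrK.
  - by apply: cC; rewrite /GRing.comm mulrA.
  - exact: ltW.
rewrite cE opprB addrA -mulr2n -scaler_nat.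
have -> : (2%:R *: (b * b) - t%:S) = (-2)%:C *: ((t / 2)%:S - b * b).
  rewrite scalerBr realSZ mulrCA mulNr divff// mulrN1 !rmorphN !scaleNr opprK addrC.
  by rewrite rmorph_nat.
rewrite cnormZr normrN ger0_norm// => H; lra.
Qed.

(** The square roots [b] and [c] of commuting elements commute, so that [u v] is the square of the
    self-adjoint [b c]. *)
Lemma positive_mul u v : GRing.comm u v -> positive u -> positive v ->
  positive (u * v).
Proof.
move=> uv up vp.
have [b [[bsa _] bE bC]] := positive_sqrt up.
have [c [[csa _] cE cC]] := positive_sqrt vp.
have cb : GRing.comm c b.
  by apply: bC; apply/esym/cC.
have -> : u * v = (b * c) * (b * c).
  by rewrite -bE -cE !mulrA -(mulrA b c b) cb !mulrA.
by apply: positive_sq; rewrite starM bsa csa.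
Qed.

(** Commuting roots of [e + t - h] and [e + t + h] have squares with sum [2 (t + e)] and difference
    [- 2 h], so that [cnorm_sqB] turns the order bounds into a norm bound. *)
Lemma cnorm_le_positive h t : 0 <= t ->
  positive (t%:S - h) -> positive (t%:S + h) -> cnorm h <= t.
Proof.
move=> t0 hm hp.
have hsa : star h = h.
  by have := positive_sa hp; rewrite starD star_real => /addrI.
apply/ler_addgt0Pr => e e0.
have e0' : positive e%:S by apply: positive_real; exact: ltW.
have [b [[bsa _] bE bC]] := positive_sqrt (positiveD e0' hm).
have [c [[csa _] cE cC]] := positive_sqrt (positiveD e0' hp).
have bc : GRing.comm b c.
  apply: cC; apply/esym/bC; rewrite !addrA -!realSD.
  apply: commrB; first exact: comm_realS.
  by apply/commr_sym/commrD => //; exact: comm_realS.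
have : cnorm (b * b - c * c) <= 2 * (t + e).
  apply: cnorm_sqB => //; first lra.
  rewrite bE cE !(addrA e%:S) -!realSD addrACA addNr addr0.
  by rewrite -realSD; congr ((_)%:C *: _); lra.
have -> : b * b - c * c = (-2)%:C *: h.
  rewrite bE cE !(addrA e%:S) -!realSD opprD addrACA subrr add0r -opprD.
  by rewrite rmorphN scaleNr rmorphD rmorph1 scalerDl scale1r.
by rewrite cnormZr normrN ger0_norm//; lra.
Qed.

Lemma cnorm_positive_le u v : positive u -> positive (v - u) ->
  cnorm u <= cnorm v.
Proof.
move=> up vu; have vsa : star v = v.
  by have := positive_sa (positiveD vu up); rewrite subrK.
apply: cnorm_le_positive; first exact: cnorm_ge0.
  rewrite -(subrK v (cnorm v)%:S) -addrA; apply: positiveD => //.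
  exact: positive_realB.
by apply: positiveD => //; apply: positive_real; exact: cnorm_ge0.
Qed.

(** The definition of [positive] provides this bound for some [t] only; here it is obtained for each
    [s] above the norm. *)
Lemma cnorm_realB_positive y s : positive y -> cnorm y <= s ->
  cnorm (s%:S - y) <= s.
Proof.
move=> yp ys; have s0 := le_trans (cnorm_ge0 y) ys.
apply: cnorm_le_positive => //; first by rewrite opprB addrC subrK.
rewrite addrA -realSD; apply: positive_realB; first exact: positive_sa.
by lra.
Qed.
End Positivity.

(** * Positivity of [a^* a] *)

Section StarSquares.
Context {R : realType} {A : cstarAlgType R}.
Implicit Types (a b c h u v w x y z : A) (r s t : R).

Local Notation "r %:S" := (r%:C%:A : A) (at level 2, format "r %:S").

(** With the self-adjoint [p = b + star b] and [q = i (b - star b)] the element is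
    [(p^2 + q^2) / 2]. *)
Lemma positive_star_mulD b : positive (star b * b + b * star b).
Proof.
set p := b + star b; set q := 'i%C *: (b - star b).
have psa : star p = p by rewrite /p starD starK addrC.
have qsa : star q = q by rewrite /q starZi starB starK -scalerN opprB.
have h0 : 0 <= 2^-1 :> R by rewrite invr_ge0.
have := positiveZ h0 (positiveD (positive_sq psa) (positive_sq qsa)).
have -> : q * q = - ((b - star b) * (b - star b)).
  by rewrite -scalerAl -scalerAr scalerA -expr2 sqr_i scaleN1r.
congr positive.
rewrite /p; set c := star b; rewrite mulrDl mulrBl 2!mulrDr 2!mulrBr !opprB.
have -> : b * b + b * c + (c * b + c * c) = c * b + b * c + (c * c + b * b).
  by rewrite addrC [b * b + _]addrC addrACA.
have -> : c * b - c * c + (b * c - b * b) = c * b + b * c - (c * c + b * b).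
  by rewrite addrACA opprD.
move: (c * b + b * c) (c * c + b * b) => S T.
rewrite addrACA subrr addr0 scalerDr -scalerDl -rmorphD.
by rewrite (_ : 2^-1 + 2^-1 = 1) ?scale1r//; field.
Qed.

(* If [b^* b <= 0] then [y = b b^*] is positive, and with [z = b^* b] and
   [s = ||b||^2] the norms of [(y - s) b = b (z - s)], computed on either side,
   are at most [s^(3/2)] and at least [(2 s^3)^(1/2)]. *)
Lemma star_mul_npos_eq0 b : positive (- (star b * b)) -> b = 0.
Proof.
set z := star b * b => vp; set v := - z in vp; set y := b * star b.
set s := cnorm b ^+ 2; have s0 : 0 <= s by rewrite sqr_ge0.
have nz : cnorm z = s by rewrite cnorm_star_mul.
have ny : cnorm y = s by rewrite cnorm_mul_star.
have yp : positive y.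
  by have := positiveD (positive_star_mulD b) vp; rewrite addrC addKr.
have ysa := positive_sa yp; have zsa : star z = z by rewrite starM starK.
have E : (y - s%:S) * b = b * (z - s%:S).
  by rewrite mulrBl mulrBr mul_realS mulr_realS mulrA.
have up : cnorm ((y - s%:S) * b) ^+ 2 <= s * (s * s).
  rewrite -cnorm_mul_star starM starB ysa star_real -mulrA (mulrA b).
  have ys : cnorm (y - s%:S) <= s.
    by rewrite cnormB cnorm_realB_positive ?ny.
  rewrite (le_trans (cnorm_le_mul _ _))// ler_pM ?cnorm_ge0//.
  by rewrite (le_trans (cnorm_le_mul _ _))// ler_pM ?cnorm_ge0 ?ny.
have low : 2 * s * s ^+ 2 <= cnorm (b * (z - s%:S)) ^+ 2.
  set w := z - s%:S; have wE : w = - (v + s%:S) by rewrite opprD opprK.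
  have wsa : star w = w by rewrite starB zsa star_real.
  have -> : cnorm (b * w) ^+ 2 = cnorm (w * (z * w)).
    rewrite -cnorm_star_mul; congr cnorm.
    by rewrite starM wsa [LHS]mulrA -(mulrA w (star b)) [RHS]mulrA.
  have -> : w * (z * w) = - ((v + s%:S) * (v * (v + s%:S))).
    by rewrite -[z]opprK wE !(mulNr, mulrN) !opprK.
  rewrite cnormN.
  have c0 : 0 <= 2 * s by rewrite mulr_ge0.
  have <- : cnorm ((2 * s)%:C *: (v * v)) = 2 * s * s ^+ 2.
    rewrite cnormZr ger0_norm// cnorm_sq; last exact: positive_sa.
    by rewrite cnormN nz.
  have vvp : positive (v * v) by apply: positive_sq; exact: positive_sa.
  apply: cnorm_positive_le; first exact: positiveZ.
  (* Since [(v + s) v (v + s) = v^3 + 2 s v^2 + s^2 v], the difference is a sum of positive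
     elements. *)
  have -> : (v + s%:S) * (v * (v + s%:S)) - (2 * s)%:C *: (v * v) =
      v * (v * v) + s%:C *: (s%:C *: v).
    rewrite mulrDr mulr_realS mulrDl mul_realS scalerDr mulrDr -scalerAr.
    rewrite mulrDl mul1r rmorphD scalerDl -!addrA; congr (_ + _).
    by rewrite addrA [LHS]addrC subrK.
  apply: positiveD; first by apply: positive_mul => //; rewrite /GRing.comm mulrA.
  by do 2 apply: positiveZ => //.
have {up low} : s * (s * s) <= 0 by move: up low; rewrite E; nra.
rewrite -expr2 -exprS => s3; have : s = 0.
  have : s ^+ 3 == 0 by rewrite eq_le s3 exprn_ge0.
  by rewrite expf_eq0 => /eqP.
by move=> /eqP; rewrite sqrf_eq0 => /eqP/cnorm_eq0.
Qed.

Lemma mul_self_eq0 h : star h = h -> h * h = 0 -> h = 0.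
Proof.
move=> hsa hh; apply: cnorm_eq0; apply/eqP; rewrite -sqrf_eq0.
by rewrite -cnorm_sq// hh cnorm0.
Qed.

(* Kelley--Vaught: with [h = a^* a], [c = |h|] and [q = c - h], the element
   [- (a q)^* (a q) = c q^2] is positive, so that [a q = 0]. *)
Lemma positive_star_mul a : positive (star a * a).
Proof.
set h := star a * a; have hsa : star h = h by rewrite starM starK.
have [c [cp cE cC]] := positive_sqrt (positive_sq hsa).
have csa := positive_sa cp.
have ch : c * h = h * c by apply/esym/cC; rewrite /GRing.comm mulrA.
set q := c - h; have qsa : star q = q by rewrite starB csa hsa.
have qc : q * c = c * q by rewrite mulrBl mulrBr ch.
have qh : q * h = - (c * q).
  by rewrite mulrBl mulrBr -cE opprB ch.
have qq : q * q = 2%:C *: (c * q).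
  by rewrite {2}/q mulrBr qc qh opprK -mulr2n -scaler_nat rmorph_nat.
have cqp : positive (c * (q * q)).
  apply: positive_mul => //; first by rewrite /GRing.comm mulrA -qc -mulrA -qc mulrA.
  exact: positive_sq.
have qhq : star (a * q) * (a * q) = - (c * (q * q)).
  by rewrite starM qsa -mulrA (mulrA (star a)) mulrA qh mulNr mulrA.
have aq : a * q = 0 by apply: star_mul_npos_eq0; rewrite qhq opprK.
have cqq : c * (q * q) = 0.
  by apply: oppr_inj; rewrite -qhq aq mulr0 oppr0.
suff : q = 0 by move=> /eqP; rewrite subr_eq0 => /eqP <-.
(* From [q^2 = 2 c q] follows [q^4 = 2 (c q^2) q = 0]; a self-adjoint element of square zero
   vanishes, which is applied to [q^2] and then to [q]. *)
apply: mul_self_eq0 => //; apply: mul_self_eq0; first by rewrite starM qsa.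
by rewrite {1}qq -scalerAl mulrA -(mulrA c) cqq mul0r scaler0.
Qed.

End StarSquares.

(** * States *)

Section RealPart.
Context {R : realType} {A : cstarAlgType R}.
Implicit Types (a b h : A) (r s t : R).

Definition re_part a : A := 2^-1%:C *: (a + star a).

Lemma half_addrr a : 2^-1%:C *: (a + a) = a.
Proof.
rewrite scalerDr -scalerDl -rmorphD (_ : 2^-1 + 2^-1 = 1) ?scale1r//.
by field.
Qed.

Lemma re_part_sa a : star (re_part a) = re_part a.
Proof. by rewrite starZr starD starK addrC. Qed.

Lemma re_part_id h : star h = h -> re_part h = h.
Proof. by move=> hsa; rewrite /re_part hsa half_addrr. Qed.

Lemma re_partD a b : re_part (a + b) = re_part a + re_part b.
Proof. by rewrite /re_part starD addrACA scalerDr. Qed.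

Lemma re_partZ r a : re_part (r%:C *: a) = r%:C *: re_part a.
Proof. by rewrite /re_part starZr -scalerDr !scalerA mulrC. Qed.

Lemma cnorm_re_part a : cnorm (re_part a) <= cnorm a.
Proof.
rewrite cnormZr gtr0_norm ?invr_gt0// ler_pdivrMl//.
by rewrite (le_trans (cnorm_le_add _ _))// cnorm_star; lra.
Qed.

Lemma re_im_part a : a = re_part a + 'i%C *: re_part (- ('i%C *: a)).
Proof.
have E : 'i%C *: (- ('i%C *: a) + 'i%C *: star a) = a - star a.
  by rewrite scalerDr scalerN !scalerA -expr2 sqr_i !scaleN1r opprK.
rewrite /re_part starN starZi opprK scalerA mulrC -scalerA E -scalerDr.
by rewrite addrACA subrr addr0 half_addrr.
Qed.

End RealPart.

Section StateTheory.
Context {R : realType} {A : cstarAlgType R} (psi : A -> R[i]).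
Hypothesis psi_state : state psi.
Implicit Types (a b h : A) (c : R[i]).

Let psi_lin : scalar psi. Proof. by case: psi_state. Qed.

Lemma stateD a b : psi (a + b) = psi a + psi b.
Proof. by rewrite -[a]scale1r psi_lin mul1r scale1r. Qed.

Lemma state0 : psi 0 = 0.
Proof. by apply: (addrI (psi 0)); rewrite -stateD !addr0. Qed.

Lemma stateZ c a : psi (c *: a) = c * psi a.
Proof. by rewrite -[c *: a]addr0 psi_lin state0 addr0. Qed.

Lemma stateN a : psi (- a) = - psi a.
Proof. by rewrite -scaleN1r stateZ mulN1r. Qed.

Lemma stateB a b : psi (a - b) = psi a - psi b.
Proof. by rewrite stateD stateN. Qed.

Lemma state_sum (I : Type) (s : seq I) (F : I -> A) :
  psi (\sum_(i <- s) F i) = \sum_(i <- s) psi (F i).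
Proof. by elim/big_rec2: _ => [|i y x _ <-]; rewrite ?state0 ?stateD. Qed.

Lemma state_scalar c : psi c%:A = c.
Proof. by rewrite stateZ; case: psi_state => _ _ ->; rewrite mulr1. Qed.

(** States are nonnegative on elements [star a * a] by definition; a positive element has this form
    through its self-adjoint square root. *)
Lemma state_positive h : positive h -> 0 <= psi h.
Proof.
move=> /positive_sqrt[c [[csa _] <- _]]; rewrite -{1}csa.
by case: psi_state.
Qed.

Lemma state_sa_real h : star h = h -> psi h \is Num.real.
Proof.
move=> hsa; have := state_positive (positive_realD hsa (lexx _)).
rewrite stateD state_scalar => /ger0_real pr.
rewrite -[psi h](addKr (cnorm h)%:C) rpredD// rpredN.
by rewrite ger0_real// lecR cnorm_ge0.
Qed.

Lemma state_sa_le h : star h = h -> `|psi h| <= (cnorm h)%:C.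
Proof.
move=> hsa; rewrite real_ler_norml ?state_sa_real//.
have := state_positive (positive_realD hsa (lexx _)).
have := state_positive (positive_realB hsa (lexx _)).
rewrite stateB stateD !state_scalar => hm hp; apply/andP; split.
  by rewrite -subr_ge0 opprK addrC.
by rewrite -subr_ge0.
Qed.

(** The factor 2 comes from bounding the real and imaginary parts separately; continuity of states
    follows all the same. *)
Lemma state_le a : `|psi a| <= (2 * cnorm a)%:C.
Proof.
rewrite {1}[a]re_im_part stateD stateZ (le_trans (ler_normD _ _))//.
rewrite normrM (_ : `|'i%C| = 1 :> R[i]) ?mul1r; last first.
  by rewrite normc_def /= expr0n expr1n add0r sqrtr1.
have -> : 2 * cnorm a = cnorm a + cnorm a by ring.
rewrite rmorphD lerD// (le_trans (state_sa_le (re_part_sa _)))// lecR.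
  exact: cnorm_re_part.
by rewrite (le_trans (cnorm_re_part _))// cnormN cnormZi.
Qed.

End StateTheory.

Lemma norm_weakly_converges (R : realType) (A : cstarAlgType R)
    (u : nat -> A) (a : A) :
  norm_converges u a -> weakly_converges u a.
Proof.
move=> ua psi ps; apply/cvgrPdist_lt => e; case: e => e1 e2.
(* In the order of [R[i]], [0 < e] forces [e] to be real. *)
rewrite ltcE /= => /andP[/eqP -> e0].
have e20 : 0 < e1 / 2 by rewrite divr_gt0.
have /cvgrPdist_lt/(_ _ e20) := ua; apply: filterS => n.
rewrite sub0r normrN ger0_norm ?cnorm_ge0// => H.
rewrite -(stateB ps) (le_lt_trans (state_le ps _))// cnormB.
rewrite -[_ +i* _]/(e1%:C) ltcR; lra.
Qed.

(** * The Hahn--Banach theorem *)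

Section HahnBanach.
Context {R : realType} {V : lmodType R}.
Implicit Types (p q : V -> R) (u v w x y : V) (r s t : R).

Definition sublinear q : Prop :=
  (forall u v, q (u + v) <= q u + q v) /\
  (forall r u, 0 < r -> q (r *: u) <= r * q u).

Lemma sublinearZ q r u : sublinear q -> 0 < r -> q (r *: u) = r * q u.
Proof.
move=> [_ qZ] r0; apply/eqP; rewrite eq_le qZ//= -ler_pdivlMl//.
have {1}-> : u = r^-1 *: (r *: u) by rewrite scalerK// gt_eqF.
by rewrite qZ ?invr_gt0.
Qed.

Lemma sublinear0 q : sublinear q -> q 0 = 0.
Proof.
move=> qs; have := @sublinearZ q 2 0 qs; rewrite scaler0 => /(_ ltac:(lra)); lra.
Qed.

Lemma sublinear_ge q x : sublinear q -> - q (- x) <= q x.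
Proof.
by move=> qs; have [qD _] := qs; have := qD x (- x); rewrite subrr sublinear0//; lra.
Qed.

(* An infimum is sublinear as soon as the sets [T x] of its competitors are
   compatible with sums and positive multiples. *)
Lemma inf_sublinear (T : V -> set R) :
  (forall x, T x !=set0) -> (forall x, has_lbound (T x)) ->
  (forall x y s t, T x s -> T y t -> exists2 u, T (x + y) u & u <= s + t) ->
  (forall x r s, 0 < r -> T x s -> exists2 u, T (r *: x) u & u <= r * s) ->
  sublinear (fun x => inf (T x)).
Proof.
move=> T0 Tlb TD TZ; split=> [x y|r x r0].
  rewrite -lerBlDr; apply: lb_le_inf => // s Ts; rewrite lerBlDr -lerBlDl.
  apply: lb_le_inf => // t Tt; rewrite lerBlDl.
  by have [u Tu] := TD _ _ _ _ Ts Tt; apply: le_trans; exact: ge_inf.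
rewrite -ler_pdivrMl//; apply: lb_le_inf => // s Ts; rewrite ler_pdivrMl//.
by have [u Tu] := TZ _ _ _ r0 Ts; apply: le_trans; exact: ge_inf.
Qed.

(** The infimum of this set lowers a sublinear [q] along [y]: [t = 0] keeps it below [q], and
    [t = 1] makes it at most [- q y] at [- y]. *)
Definition tilt_set q y x : set R :=
  [set q (x + t *: y) - t * q y | t in [set t | 0 <= t]].

Lemma tilt_set_lb q y x : sublinear q -> lbound (tilt_set q y x) (- q (- x)).
Proof.
move=> qs _ [t /= t0 <-].
have -> : t * q y = q (t *: y).
  move: t0; rewrite le_eqVlt => /predU1P[<-|t0]; last by rewrite sublinearZ.
  by rewrite scale0r mul0r sublinear0.
have [qD _] := qs; have := qD (x + t *: y) (- x).
by rewrite addrAC subrr add0r; lra.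
Qed.

Lemma tilt_sublinear q y : sublinear q ->
  [/\ sublinear (fun x => inf (tilt_set q y x)),
      forall x, inf (tilt_set q y x) <= q x
    & forall x, inf (tilt_set q y x) <= q (x + y) - q y].
Proof.
move=> qs; have lb x : has_lbound (tilt_set q y x).
  by exists (- q (- x)); exact: tilt_set_lb.
have [qD qZ] := qs; split.
- apply: inf_sublinear => //.
  + by move=> x; exists (q (x + 0 *: y) - 0 * q y), 0 => /=.
  + move=> x z _ _ [s /= s0 <-] [t /= t0 <-].
    exists (q (x + z + (s + t) *: y) - (s + t) * q y).
      by exists (s + t) => //=; rewrite addr_ge0.
    rewrite scalerDl addrACA; have := qD (x + s *: y) (z + t *: y); lra.
  + move=> x r _ r0 [s /= s0 <-].
    exists (q (r *: x + (r * s) *: y) - (r * s) * q y).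
      by exists (r * s) => //=; rewrite mulr_ge0// ltW.
    by rewrite -scalerA -scalerDr sublinearZ// mulrBr mulrA.
- move=> x; apply: ge_inf => //; exists 0 => //=.
  by rewrite scale0r addr0 mul0r subr0.
- move=> x; apply: ge_inf => //; exists 1 => //=.
  by rewrite scale1r mul1r.
Qed.

(** Zorn's lemma for the reversed pointwise order: a chain is bounded by its pointwise infimum,
    which is finite because [q x >= - q (- x) >= - p (- x)]. *)
Lemma minimal_sublinear p : sublinear p -> exists q,
  [/\ sublinear q, forall x, q x <= p x
    & forall q', sublinear q' -> (forall x, q' x <= q x) -> q' = q].
Proof.
move=> ps; pose T := {q | sublinear q /\ forall x, q x <= p x}.
pose le (q1 q2 : T) : bool := `[< forall x, sval q2 x <= sval q1 x >].
have [||q1 q2|C Ctot|[q [qs qp]] qmin] := @Zorn T le.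
- by move=> q; apply/asboolP.
- move=> q1 q2 q3 /asboolP q12 /asboolP q23; apply/asboolP => x.
  exact: le_trans (q23 x) (q12 x).
- case: q1 q2 => [q1 h1] [q2 h2] /asboolP /= q12 /asboolP /= q21.
  have E : q1 = q2 by apply/funext => x; apply/eqP; rewrite eq_le q12 q21.
  by subst q2; congr exist; exact: Prop_irrelevance.
- have [[q0 Cq0]|C0] := pselect (exists q : T, C q); last first.
    by exists (exist _ p (conj ps (fun x => lexx _))) => q Cq; case: C0; exists q.
  pose S x := [set sval q x | q in C].
  have Slb x : has_lbound (S x).
    exists (- p (- x)) => _ [[q [qs qp]] _ <-] /=.
    by rewrite (le_trans _ (sublinear_ge x qs))// lerN2.
  have Ss : sublinear (fun x => inf (S x)).
    apply: inf_sublinear => //.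
    + by move=> x; exists (sval q0 x), q0.
    + move=> x y _ _ [q1 Cq1 <-] [q2 Cq2 <-].
      (* Two members of the chain are comparable, and the smaller one serves at both [x] and [y]. *)
      wlog le12 : q1 q2 x y Cq1 Cq2 / le q1 q2.
        move=> H; case: (Ctot _ _ Cq1 Cq2) => le12; first exact: H.
        have [u] := H q2 q1 y x Cq2 Cq1 le12.
        by rewrite addrC [X in _ <= X]addrC; exists u.
      exists (sval q2 (x + y)); first by exists q2.
      case: q2 Cq2 le12 => q2 [[q2D q2Z] q2p] /= Cq2 /asboolP /= le12.
      by rewrite (le_trans (q2D _ _))// lerD.
    + move=> x r _ r0 [q1 Cq1 <-]; exists (sval q1 (r *: x)); first by exists q1.
      by have [[_ q1Z] _] := svalP q1; exact: q1Z.
  have Sp x : inf (S x) <= p x.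
    apply: le_trans (ge_inf (Slb x) (_ : S x (sval q0 x))) _; first by exists q0.
    by case: q0 {Cq0} => q0 [] /=.
  pose P q := sublinear q /\ forall x, q x <= p x.
  exists (exist P _ (conj Ss Sp)) => q Cq; apply/asboolP => x /=.
  by apply: ge_inf => //; exists q.
- exists q; split=> // q' q's q'q.
  have q'p x : q' x <= p x by apply: le_trans (q'q x) (qp x).
  have /(congr1 sval) : (exist _ q' (conj q's q'p) : T) = exist _ q (conj qs qp).
    by apply: qmin; apply/asboolP.
  by [].
Qed.

(* A minimal sublinear functional is linear, since tilting it along any
   direction does not decrease it. *)
Lemma hahn_banach p (x0 : V) : sublinear p -> exists f : V -> R,
  [/\ scalar f, forall x, f x <= p x & f x0 = p x0].
Proof.
move=> ps; have [p0s p0p p0t] := tilt_sublinear x0 ps.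
have [f [fs fp0 fmin]] := minimal_sublinear p0s.
have fD x y : f (x + y) = f x + f y.
  apply/eqP; rewrite eq_le fs.1/= -lerBrDr.
  have [ts tf tt] := tilt_sublinear y fs.
  by rewrite -{1}(fmin _ ts tf).
have fN x : f (- x) = - f x.
  by apply/eqP; rewrite -addr_eq0 -fD addNr sublinear0.
have fZ r x : f (r *: x) = r * f x.
  have [r0|r0|->] := ltgtP r 0.
  - by rewrite -{1}[r]opprK scaleNr fN sublinearZ ?oppr_gt0// mulNr opprK.
  - exact: sublinearZ.
  - by rewrite scale0r mul0r sublinear0.
exists f; split.
- by move=> r x y; rewrite fD fZ.
- by move=> x; apply: le_trans (fp0 x) (p0p x).
- apply/eqP; rewrite eq_le (le_trans (fp0 _) (p0p _))/=.
  (* At [- x0] the tilt along [x0] is at most [p 0 - p x0 = - p x0], which forces [f x0 >= p x0]. *)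
  have := le_trans (fp0 (- x0)) (p0t (- x0)).
  by rewrite addNr sublinear0// sub0r fN lerN2.
Qed.

End HahnBanach.

(** * Folner sets from invariant means *)

Section FinitelySupported.
Context {R : realType} {T : choiceType}.
Implicit Types (S : {fset T}) (r : R).

Definition finsupp_pred : {pred (T -> R)} :=
  fun f => `[< exists S : {fset T}, forall x, x \notin S -> f x = 0 >].

Lemma finsupp_submod_closed : submod_closed finsupp_pred.
Proof.
split=> [|r f g /asboolP[S fS] /asboolP[S' gS']].
  by apply/asboolP; exists fset0.
apply/asboolP; exists (S `|` S')%fset => x; rewrite inE negb_or => /andP[xS xS'].
have -> : (r *: f + g) x = r * f x + g x by [].
by rewrite fS// gS'// mulr0 addr0.
Qed.

HB.instance Definition _ := GRing.isSubmodClosed.Build R (T -> R) finsupp_pred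
  finsupp_submod_closed.

(** This is the free vector space on [T]. A linear functional on it that is dominated by the l^1
    norm amounts to a bounded function on [T], its values at point masses. *)
Record finsupp := FinSupp { finsupp_fun :> T -> R ; _ : finsupp_fun \in finsupp_pred }.

HB.instance Definition _ := [isSub for finsupp_fun].
HB.instance Definition _ := [Choice of finsupp by <:].
HB.instance Definition _ := [SubChoice_isSubLmodule of finsupp by <:].

Implicit Types f g h : finsupp.

Lemma finsuppD f g x : (f + g) x = f x + g x.
Proof. by []. Qed.

Lemma finsuppN f x : (- f) x = - f x.
Proof. by []. Qed.

Lemma finsuppZ r f x : (r *: f) x = r * f x.
Proof. by []. Qed.

Lemma finsupp_ext f g : (forall x, f x = g x) -> f = g.
Proof. by move=> fg; apply/val_inj/funext. Qed.

Lemma finsuppP f : exists S, forall x, x \notin S -> f x = 0.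
Proof. by case: f => f fP; exact/asboolP. Qed.

Definition l1norm f : R := \sum_(x \in [set: T]) `|f x|.

Lemma l1normE f S : (forall x, x \notin S -> f x = 0) ->
  l1norm f = \sum_(x <- S) `|f x|.
Proof. by move=> fS; apply: fsbigTE => x /fS ->; rewrite normr0. Qed.

Lemma finsupp3P f g h : exists S,
  forall x, x \notin S -> [/\ f x = 0, g x = 0 & h x = 0].
Proof.
have [[S fS] [S' gS'] [S'' hS'']] := And3 (finsuppP f) (finsuppP g) (finsuppP h).
exists (S `|` S' `|` S'')%fset => x; rewrite !inE !negb_or -andbA.
by case/and3P => /fS ? /gS' ? /hS'' ?.
Qed.

Lemma l1normD_eq f g h : (forall x, `|f x| = `|g x| + `|h x|) ->
  l1norm f = l1norm g + l1norm h.
Proof.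
move=> fgh; have [S fS] := finsupp3P f g h.
rewrite !(@l1normE _ S)//; try by move=> x /fS[].
by rewrite -big_split/=; apply: eq_bigr => x _.
Qed.

Lemma ler_l1normD f g : l1norm (f + g) <= l1norm f + l1norm g.
Proof.
have [S fS] := finsupp3P f g (f + g).
rewrite !(@l1normE _ S)//; try by move=> x /fS[].
by rewrite -big_split/=; apply: ler_sum => x _; exact: ler_normD.
Qed.

Lemma l1normZ r f : l1norm (r *: f) = `|r| * l1norm f.
Proof.
have [S fS] := finsupp3P f f (r *: f).
rewrite !(@l1normE _ S)//; try by move=> x /fS[].
by rewrite mulr_sumr; apply: eq_bigr => x _; rewrite finsuppZ normrM.
Qed.

Lemma l1normN f : l1norm (- f) = l1norm f.
Proof. by rewrite -scaleN1r l1normZ normrN1 mul1r. Qed.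

Lemma l1norm0 : l1norm 0 = 0.
Proof. by rewrite -(scale0r (0 : finsupp)) l1normZ normr0 mul0r. Qed.

Lemma l1norm_ge0 f : 0 <= l1norm f.
Proof.
by have [S fS] := finsuppP f; rewrite (l1normE fS) sumr_ge0.
Qed.

Lemma ler_sum_l1norm f S : \sum_(x <- S) `|f x| <= l1norm f.
Proof.
have [S' fS'] := finsuppP f.
have fU x : x \notin (S `|` S')%fset -> f x = 0.
  by rewrite inE negb_or => /andP[_ /fS'].
rewrite (l1normE fU) [leRHS](bigID (mem S))/=.
rewrite -[leLHS]addr0 lerD ?sumr_ge0//.
rewrite -[in leRHS]big_filter le_eqVlt; apply/orP; left; apply/eqP.
apply: perm_big.
apply: uniq_perm; rewrite ?filter_uniq ?fset_uniq// => x.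
by rewrite mem_filter inE; case: (x \in S).
Qed.

Lemma indic_finsupp S : (fun x => (x \in S)%:R : R) \in finsupp_pred.
Proof. by apply/asboolP; exists S => x /negbTE ->. Qed.

Definition findic S : finsupp := FinSupp (indic_finsupp S).

Lemma findicE S x : findic S x = (x \in S)%:R.
Proof. by []. Qed.

Lemma l1norm_findic S : l1norm (findic S) = #|` S|%:R.
Proof.
rewrite (@l1normE _ S) => [|x /negbTE xS]; last by rewrite findicE xS.
rewrite (eq_big_seq (fun=> 1)) => [|x xS].
  by rewrite big_const_seq count_predT iter_addr_0.
by rewrite findicE xS normr1.
Qed.

End FinitelySupported.
Arguments finsupp : clear implicits.

Section FolnerSets.
Context {R : realType}.

(** Invariance is left out, so that a mean can be paired with any family of bijections of any
    set. *)
Record is_mean (X : Type) (M : (X -> R) -> R) : Prop := IsMean {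
  is_mean_linear : forall (c : R) (f h : X -> R), bounded_fun f ->
    bounded_fun h -> M (fun x => c * f x + h x) = c * M f + M h;
  is_mean_ge0 : forall f : X -> R, bounded_fun f ->
    (forall x, 0 <= f x) -> 0 <= M f;
  is_mean_1 : M (fun=> 1) = 1
}.

Lemma bounded_funP (X : Type) (f : X -> R) :
  bounded_fun f <-> exists C, forall x, `|f x| <= C.
Proof.
split=> [[C [_ fC]]|[C fC]].
  by exists (C + 1) => x; apply: fC => //; rewrite ltrDl.
by exists C; split; [exact: num_real|move=> r Cr x _; exact: le_trans (fC x) (ltW Cr)].
Qed.

Lemma bounded_cst (X : Type) (c : R) : bounded_fun ((fun=> c) : X -> R).
Proof. by apply/bounded_funP; exists `|c|. Qed.

Section MeanTheory.
Context {X : Type} (M : (X -> R) -> R).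
Hypothesis MM : is_mean M.
Implicit Types f h : X -> R.

Lemma meanD f h : bounded_fun f -> bounded_fun h ->
  M (fun x => f x + h x) = M f + M h.
Proof.
move=> bf bh; rewrite -[M f]mul1r -is_mean_linear//; congr M.
by apply/funext => x; rewrite mul1r.
Qed.

Lemma mean0 : M (fun=> 0) = 0.
Proof.
apply: (addrI (M (fun=> 0))); rewrite addr0 -meanD; try exact: bounded_cst.
by congr M; apply/funext => x; rewrite addr0.
Qed.

Lemma meanN f : bounded_fun f -> M (fun x => - f x) = - M f.
Proof.
move=> bf; rewrite -mulN1r -[RHS]addr0 -mean0 -is_mean_linear//.
  by congr M; apply/funext => x; rewrite mulN1r addr0.
exact: bounded_cst.
Qed.

Lemma mean_cst c : M (fun=> c) = c.
Proof.
rewrite -[RHS]mulr1 -(is_mean_1 MM) -[RHS]addr0 -mean0 -is_mean_linear//.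
- by congr M; apply/funext => x; rewrite mulr1 addr0.
- exact: bounded_cst.
- exact: bounded_cst.
Qed.

Lemma bounded_funD f h : bounded_fun f -> bounded_fun h ->
  bounded_fun (fun x => f x + h x).
Proof.
move=> /bounded_funP[C fC] /bounded_funP[D hD]; apply/bounded_funP.
by exists (C + D) => x; rewrite (le_trans (ler_normD _ _))// lerD.
Qed.

Lemma bounded_funN f : bounded_fun f -> bounded_fun (fun x => - f x).
Proof.
by move=> /bounded_funP[C fC]; apply/bounded_funP; exists C => x; rewrite normrN.
Qed.

Lemma mean_sum (I : Type) (r : seq I) (F : I -> X -> R) :
  (forall i, bounded_fun (F i)) ->
  bounded_fun (fun x => \sum_(i <- r) F i x) /\
  M (fun x => \sum_(i <- r) F i x) = \sum_(i <- r) M (F i).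
Proof.
move=> bF; elim: r => [|i r [br IH]].
  rewrite big_nil (_ : (fun _ => _) = fun=> 0); last first.
    by apply/funext => x; rewrite big_nil.
  by split; [exact: bounded_cst|exact: mean0].
rewrite big_cons (_ : (fun _ => _) = fun x => F i x + \sum_(j <- r) F j x).
  by split; [exact: bounded_funD|rewrite meanD// IH].
by apply/funext => x; rewrite big_cons.
Qed.

Lemma mean_le f c : bounded_fun f -> (forall x, f x <= c) -> M f <= c.
Proof.
move=> bf fc; rewrite -[leRHS]mean_cst -subr_ge0 -meanN// -meanD.
- apply: is_mean_ge0 => // [|x]; last by rewrite subr_ge0.
  by apply: bounded_funD; [exact: bounded_cst|exact: bounded_funN].
- exact: bounded_cst.
- exact: bounded_funN.
Qed.

Lemma mean_ge c f : bounded_fun f -> (forall x, c <= f x) -> c <= M f.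
Proof.
move=> bf fc; rewrite -lerN2 -meanN//; apply: mean_le; first exact: bounded_funN.
by move=> x; rewrite lerN2.
Qed.

End MeanTheory.

Lemma seq_min_exists (X : eqType) (f : X -> R) (l : seq X) : l != [::] ->
  exists2 x0, x0 \in l & {in l, forall x, f x0 <= f x}.
Proof.
elim: l => // x [|y l] IH _.
  by exists x; rewrite ?mem_head// => y; rewrite inE => /eqP ->.
have [//|x0 x0l x0min] := IH.
have [le_x|/ltW le_x] := leP (f x) (f x0); [exists x|exists x0].
- by rewrite mem_head.
- by move=> z; rewrite inE => /predU1P[->//|/x0min]; exact: le_trans.
- by rewrite inE x0l orbT.
- by move=> z; rewrite inE => /predU1P[->//|/x0min].
Qed.

Section Bijections.
Context {X : choiceType} {I : finType} (s t : I -> X -> X).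
Hypothesis stK : forall i, cancel (s i) (t i).
Hypothesis tsK : forall i, cancel (t i) (s i).
Implicit Types (w : finsupp R X) (F : {fset X}).

Lemma coboundary_finsupp w :
  (fun xi : X * I => w (s xi.2 xi.1) - w xi.1) \in finsupp_pred (R := R).
Proof.
have [S wS] := finsuppP w; apply/asboolP.
pose P := [fset p in [seq (x, i) | x <- S, i <- enum I]]%fset.
have PE x i : ((x, i) \in P) = (x \in S).
  apply/idP/idP; rewrite in_fset; last first.
    by move=> xS; rewrite /= allpairs_f// mem_enum.
  by move=> /allpairsP[[y j] /= [yS _ [-> _]]].
(* A nonzero value at [(x, i)] requires [x] or [s i x] to lie in [S]; in the second case [x] is in
   the image of [S] under [t i]. *)
exists ([fset (t p.2 p.1, p.2) | p in P] `|` P)%fset => -[x i].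
rewrite inE negb_or PE => /andP[/= xiS xS].
rewrite !wS ?subr0//; apply: contraNN xiS => xS'.
by apply/imfsetP; exists (s i x, i); rewrite ?PE//= stK.
Qed.

(** For the indicator of [F], the l^1 norm of the coboundary is the sum over [i] of the sizes of the
    symmetric differences of [t i F] and [F]. *)
Definition coboundary w : finsupp R (X * I)%type := FinSupp (coboundary_finsupp w).

Lemma coboundaryE w x i : coboundary w (x, i) = w (s i x) - w x.
Proof. by []. Qed.

Lemma coboundaryD w w' : coboundary (w + w') = coboundary w + coboundary w'.
Proof.
by apply: finsupp_ext => -[x i]; rewrite finsuppD !coboundaryE !finsuppD; ring.
Qed.

Lemma coboundaryZ r w : coboundary (r *: w) = r *: coboundary w.
Proof.
by apply: finsupp_ext => -[x i]; rewrite finsuppZ !coboundaryE !finsuppZ; ring.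
Qed.

(* Layer cake: peeling off the minimal level set of [w] splits both norms. *)
Lemma coboundary_isoperimetric c : 0 <= c ->
  (forall F, c * #|` F|%:R <= l1norm (coboundary (findic F))) ->
  forall w, (forall x, 0 <= w x) -> c * l1norm w <= l1norm (coboundary w).
Proof.
move=> c0 Hc w; have [S] := finsuppP w.
move: {2}#|` S| (leqnn #|` S|) => n; elim: n S w => [|n IH] S w Sn wS w0.
  have -> : w = 0.
    apply: finsupp_ext => x; apply: wS.
    by move: Sn; rewrite leqn0 cardfs_eq0 => /eqP ->.
  by rewrite l1norm0 mulr0 l1norm_ge0.
have [S0|Sne] := eqVneq S fset0; first by apply: (IH S) => //; rewrite S0 cardfs0.
have [x0 x0S x0min] : exists2 x0, x0 \in S & {in S, forall x, w x0 <= w x}.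
  apply: seq_min_exists; apply: contra_neq Sne => S0.
  by apply/fsetP => x; rewrite inE -[x \in S]/(x \in enum_fset S) S0.
pose w' := w - w x0 *: findic S.
have w'E x : w' x = w x - w x0 * (x \in S)%:R by [].
have w'0 x : 0 <= w' x.
  rewrite w'E; have [/x0min|xS] := boolP (x \in S); last by rewrite mulr0 subr0.
  by rewrite mulr1 subr_ge0.
have w'S x : x \notin (S `\ x0)%fset -> w' x = 0.
  rewrite w'E !inE negb_and negbK => /orP[/eqP ->|xS].
    by rewrite x0S mulr1 subrr.
  by rewrite (negbTE xS) mulr0 subr0 wS.
have := IH _ _ _ w'S w'0; rewrite -ltnS (leq_trans _ Sn); last first.
  by rewrite [leqRHS](cardfsD1 x0) x0S.
move=> /(_ isT) {}IH.
have wE : w = w' + w x0 *: findic S by rewrite subrK.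
have w00 := w0 x0.
have -> : l1norm w = l1norm w' + l1norm (w x0 *: findic S).
  apply: l1normD_eq => x; rewrite {1}wE finsuppD.
  have S0 : 0 <= (w x0 *: findic S) x by rewrite finsuppZ mulr_ge0// findicE.
  by rewrite !ger0_norm// addr_ge0.
(* Nothing cancels: the indicator has an increment only if exactly one of [x], [s i x] lies in [S],
   and there [w'] vanishes at the other point, so both increments have the same sign. *)
have -> : l1norm (coboundary w) =
    l1norm (coboundary w') + l1norm (coboundary (w x0 *: findic S)).
  apply: l1normD_eq => -[x i]; rewrite {1}wE coboundaryD finsuppD !coboundaryE.
  rewrite !finsuppZ !findicE.
  have out y : y \notin S -> w' y = 0.
    by move=> yS; apply: w'S; rewrite !inE (negbTE yS) andbF.
  have [sxS|/[dup] /out -> sxS] := boolP (s i x \in S);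
    have [xS|/[dup] /out -> xS] := boolP (x \in S);
    rewrite ?(mulr1, mulr0, subr0, sub0r, subrr, addr0, normr0, normrN)//.
  - by rewrite !ger0_norm// addr_ge0.
  - by rewrite -opprD normrN !ger0_norm// addr_ge0.
rewrite coboundaryZ !l1normZ l1norm_findic mulrDr lerD// ger0_norm//.
by rewrite mulrCA ler_wpM2l.
Qed.

Variable M : (X -> R) -> R.
Hypothesis MM : is_mean M.
Hypothesis Mt : forall i f, bounded_fun f -> M (f \o t i) = M f.

(** Indeed [s i y = x] exactly when [y = t i x]. This expresses a linear functional at the
    coboundary through its values at point masses. *)
Lemma coboundary_findic1 x : coboundary (findic [fset x]%fset) =
  \sum_i (findic [fset (t i x, i)]%fset - findic [fset (x, i)]%fset).
Proof.
apply: finsupp_ext => -[y j].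
have -> (F : I -> finsupp R (X * I)%type) p : (\sum_i F i) p = \sum_i F i p.
  by elim/big_rec2: _ => // i z u _ <-.
rewrite coboundaryE (bigD1 j)// big1 => [|i /andP[_ ij]].
  rewrite -[RHS]/(_ + 0) addr0 finsuppD finsuppN !findicE !inE !xpair_eqE eqxx !andbT.
  by rewrite -(can_eq (tsK j) (s j y)) stK.
rewrite finsuppD finsuppN !findicE !inE !xpair_eqE [j == i]eq_sym.
by rewrite (negbTE ij) !andbF subrr.
Qed.

(* Otherwise Hahn--Banach yields functions [f i] bounded by 1 with
   [\sum_i (f i (t i x) - f i x) <= - c] everywhere, which the mean excludes. *)
Lemma mean_isoperimetric c : 0 < c ->
  exists F, l1norm (coboundary (findic F)) < c * #|` F|%:R.
Proof.
move=> c0; apply: contrapT => /forallNP Hc.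
have Hw := coboundary_isoperimetric (ltW c0) (fun F => _ : c * #|` F|%:R <= _).
have {Hw}Hw w : (forall x, 0 <= w x) -> c * l1norm w <= l1norm (coboundary w).
  by move: w; apply: Hw => F; rewrite leNgt; apply/negP/Hc.
(* Taking [w = 0] bounds the infimum by [l1norm v]; at [v = coboundary w] it is at most
   [- c * l1norm w]. The inequality [Hw] keeps it finite. *)
pose Q (v : finsupp R (X * I)%type) : set R :=
  [set l1norm (v - coboundary w) - c * l1norm w
    | w in [set w : finsupp R X | forall x, 0 <= w x]].
have Q0 v : Q v (l1norm v).
  exists 0 => //=; rewrite l1norm0 mulr0 subr0.
  by rewrite -(scale0r 0) coboundaryZ scale0r subr0.
have Qlb v : has_lbound (Q v).
  exists (- l1norm v) => _ [w /= w0 <-].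
  rewrite -[l1norm (v - _)]l1normN opprB.
  have := ler_l1normD (coboundary w - v) v; rewrite subrK.
  by have := Hw w w0; lra.
have Qsub : sublinear (fun v => inf (Q v)).
  apply: inf_sublinear => //.
  - by move=> v; exists (l1norm v).
  - move=> v v' _ _ [w /= w0 <-] [w' /= w'0 <-].
    exists (l1norm (v + v' - coboundary (w + w')) - c * l1norm (w + w')).
      by exists (w + w') => // x; exact: addr_ge0 (w0 x) (w'0 x).
    have -> : l1norm (w + w') = l1norm w + l1norm w'.
      apply: l1normD_eq => x; rewrite finsuppD !ger0_norm//.
      exact: addr_ge0 (w0 x) (w'0 x).
    rewrite coboundaryD opprD addrACA.
    by have := ler_l1normD (v - coboundary w) (v' - coboundary w'); lra.
  - move=> v r _ r0 [w /= w0 <-].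
    exists (l1norm (r *: v - coboundary (r *: w)) - c * l1norm (r *: w)).
      by exists (r *: w) => // x; exact: mulr_ge0 (ltW r0) (w0 x).
    by rewrite coboundaryZ -scalerBr !l1normZ gtr0_norm// mulrBr mulrCA.
have [f [fL fQ _]] := hahn_banach 0 Qsub.
have fD u v : f (u + v) = f u + f v.
  by rewrite -[u]scale1r fL mul1r scale1r.
have f0 : f 0 = 0 by apply: (addrI (f 0)); rewrite -fD !addr0.
have fN u : f (- u) = - f u.
  by apply/eqP; rewrite -addr_eq0 -fD addNr f0.
have fle v : f v <= l1norm v by apply: le_trans (fQ v) _; exact: ge_inf.
pose g i x := f (findic [fset (x, i)]%fset).
have bg i : bounded_fun (g i).
  apply/bounded_funP; exists 1 => x; rewrite ler_norml.
  have := fle (findic [fset (x, i)]%fset).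
  have := fle (- findic [fset (x, i)]%fset).
  by rewrite fN l1normN l1norm_findic cardfs1 lerNl => -> ->.
have bgt i : bounded_fun (g i \o t i).
  have /bounded_funP[C gC] := bg i; apply/bounded_funP; exists C => x.
  exact: gC.
have bG i : bounded_fun (fun x => g i (t i x) - g i x).
  exact: bounded_funD (bgt i) (bounded_funN (bg i)).
have gle x : \sum_i (g i (t i x) - g i x) <= - c.
  have -> : \sum_i (g i (t i x) - g i x) = f (coboundary (findic [fset x]%fset)).
    rewrite coboundary_findic1; elim/big_rec2: _ => [|i u v _ ->].
      by rewrite f0.
    by rewrite !fD fN.
  apply: le_trans (fQ _) _; apply: ge_inf => //.
  exists (findic [fset x]%fset); first by move=> y; exact: ler0n.
  by rewrite subrr l1norm0 l1norm_findic cardfs1 mulr1 sub0r.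
have [bs Ms] := mean_sum MM (index_enum I) bG.
have := mean_le MM bs gle; rewrite Ms big1 => [|i _]; first by lra.
rewrite (meanD MM (bgt i) (bounded_funN (bg i))).
by rewrite (meanN MM)// [X in X + _](Mt _ (bg i)) subrr.
Qed.

End Bijections.
End FolnerSets.

(** * Two-sided Folner sequences *)

Section GroupFolner.
Context {R : realType} {G : groupType}.

(** Each [x] in [D] contributes a term of absolute value 1 at [(x, i)]. *)
Lemma card_le_coboundary (X : choiceType) (I : finType) (s t : I -> X -> X)
    (stK : forall i, cancel (s i) (t i)) (F D : {fset X}) (i : I) :
  {in D, forall x, (s i x \in F) != (x \in F)} ->
  #|` D|%:R <= l1norm (coboundary stK (findic F)) :> R.
Proof.
move=> DF; pose S := [fset (x, i) | x in D]%fset.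
have inji : injective (fun x : X => (x, i)) by move=> x y [].
apply: le_trans (ler_sum_l1norm _ S).
rewrite big_imfset => /=; last by move=> x y _ _; exact: inji.
rewrite [leRHS](eq_big_seq (fun=> 1)) => [|x /DF xD].
  by rewrite big_const_seq count_predT iter_addr_0.
move: xD => /=; case: (s i x \in F); case: (x \in F) => // _.
  by rewrite subr0 normr1.
by rewrite sub0r normrN normr1.
Qed.

Lemma left_invariant_is_mean (m : (G -> R) -> R) :
  left_invariant_mean m -> is_mean m.
Proof. by case. Qed.

(** The mean of [f] is taken as [m] in [g] of [m] in [h] of [f (g h^-1)]. The outer mean gives left
    invariance; the inner one gives right invariance, as [h^-1 k = (k^-1 h)^-1]. *)
Lemma amenable_biinvariant : amenable G R -> exists M : (G -> R) -> R,
  [/\ is_mean M,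
      forall g f, bounded_fun f -> M (fun x => f (g * x)%g) = M f
    & forall g f, bounded_fun f -> M (fun x => f (x * g)%g) = M f].
Proof.
move=> [m mm]; have mM := left_invariant_is_mean mm.
pose N (f : G -> R) g := m (fun h => f (g * h^-1)%g).
have bt (f : G -> R) (u : G -> G) : bounded_fun f -> bounded_fun (f \o u).
  by move=> /bounded_funP[C fC]; apply/bounded_funP; exists C => x; exact: fC.
have bN f : bounded_fun f -> bounded_fun (N f).
  move=> bf; have /bounded_funP[C fC] := bf; apply/bounded_funP; exists C => g.
  have bfg : bounded_fun (fun h => f (g * h^-1)%g).
    exact: (bt f (fun h => g * h^-1)%g).
  rewrite ler_norml; apply/andP; split.
    apply: (mean_ge mM bfg) => h.
    by have := fC (g * h^-1)%g; rewrite ler_norml => /andP[].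
  apply: (mean_le mM bfg) => h.
  by have := fC (g * h^-1)%g; rewrite ler_norml => /andP[].
exists (fun f => m (N f)); split.
- split.
  + move=> c f h bf bh; rewrite -(is_mean_linear mM)//; try exact: bN.
    congr m; apply/funext => g; rewrite /N -(is_mean_linear mM)//.
      exact: (bt f (fun h => g * h^-1)%g).
    exact: (bt h (fun h => g * h^-1)%g).
  + move=> f bf f0; apply: (is_mean_ge0 mM); first exact: bN.
    move=> g; apply: (is_mean_ge0 mM) => //.
    exact: (bt f (fun h => g * h^-1)%g).
  + rewrite -[RHS](is_mean_1 mM); congr m; apply/funext => g.
    by rewrite /N (is_mean_1 mM).
- move=> g f bf; rewrite -(mean_invariant mm g (bN f bf)); congr m.
  by apply/funext => x; congr m; apply/funext => h; rewrite mulgA.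
- move=> g f bf; congr m; apply/funext => x; rewrite /N.
  have bfx : bounded_fun (fun h => f (x * h^-1)%g).
    exact: (bt f (fun h => x * h^-1)%g).
  rewrite -(mean_invariant mm g^-1 bfx); congr m; apply/funext => h.
  by rewrite invgM invgK mulgA.
Qed.

(** The isoperimetric lemma is applied to the left and right translations by [e 0, ..., e n] at
    once, the boolean index telling the sides apart; each single symmetric difference is below the
    total. *)
Lemma folner_fset (e : nat -> G) n (c : R) : amenable G R -> 0 < c ->
  exists F : {fset G}, F != fset0 /\ forall j, (j <= n)%N ->
    #|` fsymdiff (left_translate (e j) F) F|%:R / #|` F|%:R <= c /\
    #|` fsymdiff (right_translate F (e j)) F|%:R / #|` F|%:R <= c.
Proof.
move=> /amenable_biinvariant[M [MM Ml Mr]] c0.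
pose I := (bool * 'I_n.+1)%type.
pose t (i : I) (x : G) := if i.1 then (e i.2 * x)%g else (x * e i.2)%g.
pose s (i : I) (x : G) := if i.1 then ((e i.2)^-1 * x)%g else (x * (e i.2)^-1)%g.
have stK i : cancel (s i) (t i).
  by case: i => -[] j x; rewrite /s/t/= ?mulVKg ?mulgVK.
have tsK i : cancel (t i) (s i).
  by case: i => -[] j x; rewrite /s/t/= ?mulKg ?mulgK.
have Mt i f : bounded_fun f -> M (f \o t i) = M f.
  by case: i => -[] j bf; [exact: Ml|exact: Mr].
have [F Fc] := mean_isoperimetric stK tsK MM Mt c0.
have F0 : F != fset0.
  apply: contraTneq Fc => ->; rewrite cardfs0 mulr0 -leNgt.
  exact: l1norm_ge0.
have cF : 0 < #|` F|%:R :> R by rewrite ltr0n cardfs_gt0.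
exists F; split => // j jn; rewrite -ltnS in jn.
split; rewrite ler_pdivrMr//; apply: le_trans (ltW Fc).
- apply: (card_le_coboundary stK (i := (true, Ordinal jn))) => x.
  have -> : (s (true, Ordinal jn) x \in F) = (x \in left_translate (e j) F).
    rewrite /s/=; apply/idP/imfsetP => [xF|[y /= yF ->]].
      by exists ((e j)^-1 * x)%g; rewrite //= mulVKg.
    by rewrite mulKg.
  by rewrite !inE; case: (x \in left_translate _ _); case: (x \in F).
- apply: (card_le_coboundary stK (i := (false, Ordinal jn))) => x.
  have -> : (s (false, Ordinal jn) x \in F) = (x \in right_translate F (e j)).
    rewrite /s/=; apply/idP/imfsetP => [xF|[y /= yF ->]].
      by exists (x * (e j)^-1)%g; rewrite //= mulgVK.
    by rewrite mulgK.
  by rewrite !inE; case: (x \in right_translate _ _); case: (x \in F).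
Qed.

Lemma countable_enumeration : countable [set: G] ->
  exists e : nat -> G, forall g, exists n, e n = g.
Proof.
move=> /countable_injP[code codeI].
have [e eP] : {e : nat -> G & forall n, (exists g, code g = n) -> code (e n) = n}.
  apply: (@choice _ _ (fun n g' => (exists g, code g = n) -> code g' = n)) => n.
  (* Any value is admissible at an integer that is not a code; 1 is offered. *)
  by have [[g gn]|ng] := pselect (exists g, code g = n); [exists g|exists 1%g].
exists e => g; exists (code g); apply: codeI; rewrite ?inE//.
by apply: eP; exists g.
Qed.

(** The set [F n] handles [e 0, ..., e n] with tolerance [1 / (n + 1)], so each fixed element is
    treated from some index on. *)
Lemma two_sided_folner : countable [set: G] -> amenable G R ->
  exists F : nat -> {fset G}, left_Folner R F /\ right_Folner R F.
Proof.
move=> /countable_enumeration[e eP] am.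
have c0 n : 0 < n.+1%:R^-1 :> R by rewrite invr_gt0.
have [F FP] := choice (fun n => folner_fset e n am (c0 n)).
have lim0 (r : nat -> R) j : (forall n, 0 <= r n) ->
    (forall n, (j <= n)%N -> r n <= n.+1%:R^-1) -> r @ \oo --> 0.
  move=> r0 rj; apply: (@squeeze_cvgr _ _ _ _ (fun=> 0) (fun n => n.+1%:R^-1)).
  - near=> n; rewrite r0 rj//; near: n; exact: nbhs_infty_ge.
  - exact: cvg_cst.
  - exact: cvg_harmonic.
exists F; split; split; try by move=> k; have [] := FP k.
- move=> g; have [j <-] := eP g; apply: (lim0 _ j) => n.
    by rewrite divr_ge0.
  by move=> jn; have [_ /(_ j jn)[]] := FP n.
- move=> g; have [j <-] := eP g; apply: (lim0 _ j) => n.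
    by rewrite divr_ge0.
  by move=> jn; have [_ /(_ j jn)[]] := FP n.
Unshelve.
all: by end_near.
Qed.

End GroupFolner.

(** * Averages along the action *)

Section Averages.
Context {R : realType} {A : cstarAlgType R} {G : groupType}.
Variable Theta : cstar_system A G.
Implicit Types (F : {fset G}) (a h x y : A) (g : G).

Local Notation "r %:S" := (r%:C%:A : A) (at level 2, format "r %:S").

Lemma positive_action g h : positive h -> positive (Theta g h).
Proof.
move=> /positive_sqrt[c [[csa _] <- _]]; rewrite rmorphM.
by apply: positive_sq; rewrite -star_aut_star csa.
Qed.

Lemma action_realS g r : Theta g (r%:S) = r%:S.
Proof. by rewrite linearZ rmorph1. Qed.

(** The action preserves scalars and positivity, hence the order bounds of [star a * a] by its norm,
    and these determine the norm. *)
Lemma cnorm_action g a : cnorm (Theta g a) <= cnorm a.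
Proof.
rewrite -(@ler_pXn2r _ 2)// ?nnegrE ?cnorm_ge0// -!cnorm_star_mul.
rewrite -star_aut_star -rmorphM.
apply: cnorm_le_positive; first exact: cnorm_ge0.
  rewrite -(action_realS g) -rmorphB; apply: positive_action.
  apply: positive_realB => //; first by rewrite starM starK.
apply: positiveD; first by apply: positive_real; exact: cnorm_ge0.
by apply: positive_action; exact: positive_star_mul.
Qed.

Section FixedSet.
Variable F : {fset G}.
Hypothesis F0 : F != fset0.

Let cF : 0 < #|` F|%:R :> R. Proof. by rewrite ltr0n cardfs_gt0. Qed.

Lemma AvgE x : Avg Theta F x = (#|` F|%:R^-1)%:C *: \sum_(g <- F) Theta g x.
Proof. by rewrite /Avg fmorphV rmorph_nat. Qed.

Lemma AvgD x y : Avg Theta F (x + y) = Avg Theta F x + Avg Theta F y.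
Proof.
by rewrite -scalerDr -big_split; congr (_ *: _); apply: eq_bigr => g _; rewrite rmorphD.
Qed.

Lemma AvgZ c x : Avg Theta F (c *: x) = c *: Avg Theta F x.
Proof.
rewrite /Avg (_ : \sum_(g <- F) Theta g (c *: x) =
    c *: \sum_(g <- F) Theta g x); first by rewrite !scalerA mulrC.
by rewrite scaler_sumr; apply: eq_bigr => g _; rewrite linearZ.
Qed.

Lemma AvgN x : Avg Theta F (- x) = - Avg Theta F x.
Proof. by rewrite -scaleN1r AvgZ scaleN1r. Qed.

Lemma AvgB x y : Avg Theta F (x - y) = Avg Theta F x - Avg Theta F y.
Proof. by rewrite AvgD AvgN. Qed.

Lemma Avg_star x : star (Avg Theta F x) = Avg Theta F (star x).
Proof.
rewrite !AvgE starZr; congr (_ *: _).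
elim/big_rec2: _ => [|g y z _ <-]; first exact: star0.
by rewrite starD star_aut_star.
Qed.

Lemma Avg1 : Avg Theta F 1 = 1.
Proof.
rewrite AvgE (eq_bigr (fun=> 1)) => [|g _]; last by rewrite rmorph1.
rewrite big_const_seq count_predT iter_addr_0 -(@scaler_nat R[i] A) scalerA.
by rewrite -(rmorph_nat (real_complex R)) -rmorphM mulVf ?gt_eqF// scale1r.
Qed.

Lemma positive_Avg h : positive h -> positive (Avg Theta F h).
Proof.
move=> hp; rewrite AvgE; apply: positiveZ; first by rewrite invr_ge0 ltW.
elim/big_ind: _ => [|x y|g _]; [exact: positive0|exact: positiveD|].
exact: positive_action.
Qed.

Lemma cnorm_sum_action (D : {fset G}) x :
  cnorm (\sum_(g <- D) Theta g x) <= #|` D|%:R * cnorm x.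
Proof.
rewrite (le_trans (cnorm_sum _ _))//.
rewrite (@le_trans _ _ (\sum_(g <- D) cnorm x))//.
  by apply: ler_sum => g _; exact: cnorm_action.
by rewrite big_const_seq count_predT iter_addr_0 mulr_natl.
Qed.

Lemma cnorm_Avg x : cnorm (Avg Theta F x) <= cnorm x.
Proof.
rewrite AvgE cnormZr gtr0_norm ?invr_gt0// ler_pdivrMl//.
exact: cnorm_sum_action.
Qed.

(** Averaging [Theta g x] over [F] sums the orbit of [x] over the right translate [F g]; the terms
    common to [F g] and [F] cancel. *)
Lemma cnorm_Avg_action g x : cnorm (Avg Theta F (Theta g x) - Avg Theta F x) <=
  #|` fsymdiff (right_translate F g) F|%:R / #|` F|%:R * cnorm x.
Proof.
rewrite !AvgE -scalerBr cnormZr gtr0_norm ?invr_gt0//.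
rewrite [_ / _]mulrC -mulrA ler_pM2l ?invr_gt0//.
set E := right_translate F g.
have -> : \sum_(h <- F) Theta h (Theta g x) = \sum_(h <- E) Theta h x.
  rewrite big_imfset/=; last by move=> h k _ _; exact: mulIg.
  by apply: eq_bigr => h _; rewrite actionM.
rewrite (big_fsetID _ (mem F) E) (big_fsetID _ (mem E) F)/=.
have -> : [fset y in F | y \in E]%fset = [fset y in E | y \in F]%fset.
  by apply/fsetP => y; rewrite !inE andbC.
rewrite opprD addrACA subrr add0r.
have -> : [fset y in F | y \notin E]%fset = (F `\` E)%fset.
  by apply/fsetP => y; rewrite !inE andbC.
have -> : [fset y in E | y \notin F]%fset = (E `\` F)%fset.
  by apply/fsetP => y; rewrite !inE andbC.
have := cardfsUI (E `\` F)%fset (F `\` E)%fset.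
have -> : ((E `\` F) `&` (F `\` E))%fset = fset0.
  by apply/fsetP => y; rewrite !inE; case: (y \in E); case: (y \in F).
rewrite cardfs0 addn0 => ->; rewrite natrD mulrDl.
by rewrite (le_trans (cnorm_le_add _ _))// lerD ?cnormN ?cnorm_sum_action.
Qed.

End FixedSet.

End Averages.

(** * Invariant states and averages *)

Section Realification.
Context {R : realType} (A : cstarAlgType R).

(** An alias of [A] carrying the real scalar multiplication, for use with the real Hahn--Banach
    theorem. *)
Definition realified : Type := A.

HB.instance Definition _ := GRing.Zmodule.copy realified A.

Definition real_scale (r : R) (a : realified) : realified := r%:C *: (a : A).

Lemma real_scaleA r s a : real_scale r (real_scale s a) = real_scale (r * s) a.
Proof. by rewrite /real_scale scalerA rmorphM. Qed.

Lemma real_scale1 : left_id 1 real_scale.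
Proof. by move=> a; rewrite /real_scale rmorph1 scale1r. Qed.

Lemma real_scaleDr : right_distributive real_scale +%R.
Proof. by move=> r a b; exact: scalerDr. Qed.

Lemma real_scaleDl a : {morph real_scale^~ a : r s / r + s}.
Proof. by move=> r s; rewrite /real_scale rmorphD scalerDl. Qed.

HB.instance Definition _ := GRing.Zmodule_isLmodule.Build R realified
  real_scaleA real_scale1 real_scaleDr real_scaleDl.

End Realification.

Section InvariantStates.
Context {R : realType} {A : cstarAlgType R} {G : groupType}.
Variables (Theta : cstar_system A G) (F : nat -> {fset G}).
Hypothesis FF : right_Folner R F.
Implicit Types (a h x y : A) (r s t : R).

Local Notation "r %:S" := (r%:C%:A : A) (at level 2, format "r %:S").

Let F0 k : F k != fset0. Proof. by case: FF. Qed.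

(** The infimum of this set is the limsup over [k] of the largest spectral value of the real part of
    the average. *)
Definition eventual_bounds x : set R :=
  [set t | \forall k \near \oo, positive ((t%:S) - re_part (Avg Theta (F k) x))].

Lemma positive_real_ge0 r : positive (r%:S) -> 0 <= r.
Proof.
move=> [_ [t t0]]; rewrite -scalerBl -rmorphB cnorm_real ler_norml.
by move=> /andP[_]; lra.
Qed.

Lemma eventual_bounds_cnorm x : eventual_bounds x (cnorm x).
Proof.
apply: nearW => k; apply: positive_realB; first exact: re_part_sa.
by rewrite (le_trans (cnorm_re_part _))// cnorm_Avg.
Qed.

Lemma eventual_bounds_ge x t : eventual_bounds x t -> - cnorm x <= t.
Proof.
move=> [N _ tN]; rewrite -subr_ge0 opprK; apply: positive_real_ge0.
have xp : positive ((cnorm x)%:S + re_part (Avg Theta (F N) x)).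
  apply: positive_realD; first exact: re_part_sa.
  by rewrite (le_trans (cnorm_re_part _))// cnorm_Avg.
have := positiveD (tN N (leqnn N)) xp.
by rewrite (addrC (cnorm x)%:S) addrA subrK -realSD.
Qed.

Lemma eventual_bounds_lb x : has_lbound (eventual_bounds x).
Proof. by exists (- cnorm x) => t; exact: eventual_bounds_ge. Qed.

Definition asymptotic_max x : R := inf (eventual_bounds x).

Lemma asymptotic_max_le x t : eventual_bounds x t -> asymptotic_max x <= t.
Proof. by move=> xt; apply: ge_inf => //; exact: eventual_bounds_lb. Qed.

Lemma asymptotic_max_sublinear :
  sublinear (asymptotic_max : realified A -> R).
Proof.
apply: inf_sublinear => [x|x|x y s t xs yt|x r s r0 xs].
- by exists (cnorm (x : A)); exact: eventual_bounds_cnorm.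
- exact: eventual_bounds_lb.
- exists (s + t) => //; near=> k.
  rewrite /eventual_bounds AvgD re_partD realSD opprD addrACA.
  by apply: positiveD; near: k.
- exists (r * s) => //; near=> k.
  rewrite AvgZ re_partZ -realSZ -scalerBr; apply: positiveZ; first exact: ltW.
  by near: k.
Unshelve.
all: by end_near.
Qed.

(** This bound and the following ones pass to any real linear functional below [asymptotic_max]: it
    vanishes on [i h], is nonnegative on positive elements, takes the value 1 at 1, and is
    invariant. *)
Lemma asymptotic_max_imag h : star h = h -> asymptotic_max ('i%C *: h) <= 0.
Proof.
move=> hsa; apply: asymptotic_max_le; apply: nearW => k.
rewrite AvgZ /re_part starZi Avg_star hsa subrr !scaler0 subr0 scale0r.
exact: positive0.
Qed.

Lemma asymptotic_max_opp_positive h : positive h -> asymptotic_max (- h) <= 0.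
Proof.
move=> hp; apply: asymptotic_max_le; apply: nearW => k.
have Ap := positive_Avg Theta (F0 k) hp.
rewrite AvgN re_part_id ?starN ?(positive_sa Ap)//.
by rewrite scale0r sub0r opprK.
Qed.

Lemma asymptotic_max_real r : asymptotic_max r%:S <= r.
Proof.
apply: asymptotic_max_le; apply: nearW => k.
by rewrite AvgZ Avg1// re_part_id ?star_real// subrr; exact: positive0.
Qed.

Lemma Avg_action_converges g x :
  norm_converges (fun k => Avg Theta (F k) (Theta g x) - Avg Theta (F k) x) 0.
Proof.
have [_ /(_ g) Fg] := FF; apply: norm_converges_le; last first.
  by move=> k; rewrite subr0; exact: cnorm_Avg_action.
by rewrite -[X in _ --> X](mul0r (cnorm x)); exact: cvgMl.
Qed.

Lemma asymptotic_max_action g x : asymptotic_max (Theta g x - x) <= 0.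
Proof.
apply/ler_addgt0Pr => e e0; rewrite add0r; apply: asymptotic_max_le.
have /cvgrPdist_lt/(_ _ e0) := Avg_action_converges g x; apply: filterS => k.
rewrite subr0 sub0r normrN ger0_norm ?cnorm_ge0// => /ltW lek.
apply: positive_realB; first exact: re_part_sa.
by rewrite (le_trans (cnorm_re_part _))// AvgB.
Qed.

(* The complex functional [x |-> f x - i f (i x)] has real part [f]. *)
Lemma invariant_state_asymptotic_max x0 : exists psi : A -> R[i],
  invariant_states Theta psi /\ complex.Re (psi x0) = asymptotic_max x0.
Proof.
have [f [fL fq fx0]] := hahn_banach (x0 : realified A) asymptotic_max_sublinear.
have fD (x y : A) : f (x + y : A) = f x + f y.
  by have := fL 1 (x : realified A) (y : realified A); rewrite scale1r mul1r.
have f0 : f (0 : A) = 0 by apply: (addrI (f (0 : A))); rewrite -fD !addr0.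
have fN (x : A) : f (- x : A) = - f x.
  by apply/eqP; rewrite -addr_eq0 -fD addNr f0.
have fZ r (x : A) : f (r%:C *: x : A) = r * f x.
  by have := fL r (x : realified A) 0; rewrite !addr0 f0 addr0.
have fi (h : A) : star h = h -> f ('i%C *: h : A) = 0.
  move=> hsa; apply/eqP; rewrite eq_le (le_trans (fq _))//=; last first.
    exact: asymptotic_max_imag.
  rewrite -oppr_le0 -fN -scalerN (le_trans (fq _))//.
  by apply: asymptotic_max_imag; rewrite starN hsa.
have f1 : f (1 : A) = 1.
  apply/eqP; rewrite eq_le; apply/andP; split.
    by apply: le_trans (fq _) _; have := asymptotic_max_real 1; rewrite scale1r.
  rewrite -lerN2 -fN; apply: le_trans (fq _) _.
  by have := asymptotic_max_real (-1); rewrite rmorphN rmorph1 scaleN1r.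
have finv g (x : A) : f (Theta g x) = f x.
  have le y : f (Theta g y) <= f y.
    by rewrite -subr_le0 -fN -fD; apply: le_trans (fq _) _; exact: asymptotic_max_action.
  apply/eqP; rewrite eq_le le/=.
  by have := le (- x); rewrite rmorphN !fN lerN2.
pose psi (x : A) : R[i] := f x +i* - f ('i%C *: x : A).
exists psi; split=> //; split; first split.
- move=> [a b] x y /=.
  have cE (z : A) : (a +i* b)%C *: z = a%:C *: z + b%:C *: ('i%C *: z).
    rewrite scalerA -scalerDl; congr (_ *: _).
    by apply/eqP; rewrite eq_complex /=; apply/andP; split; apply/eqP; ring.
  have ii (z : A) : 'i%C *: ('i%C *: z) = - z by rewrite scalerA -expr2 sqr_i scaleN1r.
  have iC (z : A) r : 'i%C *: (r%:C *: z) = r%:C *: ('i%C *: z).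
    by rewrite !scalerA mulrC.
  rewrite /psi cE !scalerDr !iC !ii !fD !fZ !fN.
  by apply/eqP; rewrite eq_complex /=; apply/andP; split; apply/eqP; ring.
- move=> a; have ap := positive_star_mul a.
  rewrite /psi fi ?oppr0; last exact: positive_sa.
  rewrite lecE /= eqxx/= -oppr_le0 -fN (le_trans (fq _))//.
  exact: asymptotic_max_opp_positive.
- by rewrite /psi f1 fi ?star1// oppr0.
- move=> g; apply/funext => x /=.
  by rewrite /psi -linearZ !finv.
Qed.

End InvariantStates.

(** * From uniqueness to norm convergence *)

Section UniqueErgodicity.
Context {R : realType} {A : cstarAlgType R} {G : groupType}.
Variables (Theta : cstar_system A G) (F : nat -> {fset G}).
Hypothesis FF : right_Folner R F.

Local Notation "r %:S" := (r%:C%:A : A) (at level 2, format "r %:S").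

Lemma uniquely_ergodic_norm_converges phi :
  invariant_states Theta = [set phi] ->
  forall x, norm_converges (fun k => Avg Theta (F k) x) (phi x)%:A.
Proof.
move=> uniq; have F0 k : F k != fset0 by case: FF.
have [ps _] : invariant_states Theta phi by rewrite uniq.
(* The invariant state attaining [asymptotic_max] at [x] could depend on [x]; uniqueness makes it
   [phi] throughout. *)
have maxE x : asymptotic_max Theta F x = complex.Re (phi x).
  have [psi [ipsi <-]] := invariant_state_asymptotic_max Theta FF x.
  by move: ipsi; rewrite uniq => ->.
have ubound x e : 0 < e -> \forall k \near \oo,
    positive ((complex.Re (phi x) + e)%:S - re_part (Avg Theta (F k) x)).
  move=> e0; have [|t xt te] := @inf_adherent _ (eventual_bounds Theta F x) e e0.
    split; last exact: (eventual_bounds_lb Theta FF).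
    by exists (cnorm x); exact: (eventual_bounds_cnorm Theta FF).
  rewrite -[inf _]/(asymptotic_max Theta F x) maxE in te.
  move: xt; apply: filterS => k tk.
  rewrite -(subrK t (_ + e)) realSD -addrA; apply: positiveD => //.
  by apply: positive_real; rewrite subr_ge0 ltW.
have sa_conv h : star h = h ->
    norm_converges (fun k => Avg Theta (F k) h) (phi h)%:A.
  move=> hsa; apply/cvgrPdist_le => e e0.
  (* The upper bound for [- h] is a lower bound for [h]; together they are the hypotheses of
     [cnorm_le_positive]. *)
  have up := ubound h e e0; have um := ubound (- h) e e0; near=> k.
  rewrite sub0r normrN ger0_norm ?cnorm_ge0//.
  have Asa : star (Avg Theta (F k) h) = Avg Theta (F k) h by rewrite Avg_star hsa.
  have -> : phi h = (complex.Re (phi h))%:C.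
    by rewrite RRe_real// (state_sa_real ps).
  apply: cnorm_le_positive; first exact: ltW.
    rewrite opprB addrA -realSD (addrC e) -(re_part_id Asa).
    by near: k.
  have : positive ((complex.Re (phi (- h)) + e)%:S - re_part (Avg Theta (F k) (- h))).
    by near: k.
  rewrite (stateN ps) AvgN re_part_id ?starN ?Asa// opprK.
  congr positive; rewrite raddfN realSD rmorphN scaleNr.
  by rewrite -addrA addrC -addrA.
have iAvg k x : Avg Theta (F k) x = Avg Theta (F k) (re_part x) +
    'i%C *: Avg Theta (F k) (re_part (- ('i%C *: x))).
  by rewrite -AvgZ -AvgD -re_im_part.
move=> x; rewrite [x in phi x]re_im_part (stateD ps) (stateZ ps).
rewrite scalerDl -scalerA /norm_converges; under eq_fun do rewrite iAvg.
apply: norm_convergesD; last apply: norm_convergesZ.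
  by apply: sa_conv; exact: re_part_sa.
by apply: sa_conv; exact: re_part_sa.
Unshelve.
all: by end_near.
Qed.

End UniqueErgodicity.

Section WeakConvergence.
Context {R : realType} {A : cstarAlgType R} {G : groupType}.
Variables (Theta : cstar_system A G) (F : nat -> {fset G}).
Hypothesis F0 : forall k, F k != fset0.

Lemma invariant_state_Avg psi k x : invariant_states Theta psi ->
  psi (Avg Theta (F k) x) = psi x.
Proof.
move=> [ps inv]; rewrite /Avg (stateZ ps) (state_sum ps).
rewrite (eq_bigr (fun=> psi x)) => [|g _]; last by rewrite -[in RHS](inv g).
rewrite big_const_seq count_predT iter_addr_0 -(mulr_natl (psi x)) mulrA mulVf ?mul1r//.
by rewrite pnatr_eq0 cardfs_eq0.
Qed.

(** An invariant [psi] is constant along the averages, so that its limit is [psi x], while at the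
    weak limit [psi] takes the value [phi x]. *)
Lemma weakly_converges_invariant_state phi psi x :
  weakly_converges (fun k => Avg Theta (F k) x) (phi x)%:A ->
  invariant_states Theta psi -> psi x = phi x.
Proof.
move=> wx ipsi; have [ps _] := ipsi; have := wx psi ps.
rewrite (state_scalar ps) (_ : (fun k => _) = fun=> psi x).
  by move=> /(cvg_unique _ (@cvg_cst _ _ _ _ _)); apply.
by apply/funext => k; rewrite invariant_state_Avg.
Qed.

End WeakConvergence.

(** * The equivalence of the five conditions *)

Theorem theorem3p1 (R : realType) (A : cstarAlgType R) (G : groupType)
    (Theta : cstar_system A G)
    (A_separable : separable A)
    (G_countable : countable [set: G])
    (G_amenable : amenable G R) :
  [<->
    (* (i) *)
    uniquely_ergodic Theta;
    (* (ii) *)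
    exists (F : nat -> {fset G}) (phi : A -> R[i]),
      [/\ left_Folner R F, linear_functional phi
        & forall x : A, norm_converges (fun k => Avg Theta (F k) x) (phi x)%:A];
    (* (iii) *)
    exists (F : nat -> {fset G}) (phi : A -> R[i]),
      [/\ left_Folner R F, linear_functional phi
        & forall x : A,
            weakly_converges (fun k => Avg Theta (F k) x) (phi x)%:A];
    (* (iv) *)
    exists phi : A -> R[i], state phi /\
      forall F : nat -> {fset G}, right_Folner R F ->
      forall x : A, norm_converges (fun k => Avg Theta (F k) x) (phi x)%:A;
    (* (v) *)
    exists phi : A -> R[i], state phi /\
      forall F : nat -> {fset G}, right_Folner R F ->
      forall x : A, weakly_converges (fun k => Avg Theta (F k) x) (phi x)%:A].
Proof.
(* This sequence is the left one asked for in (ii) and, as a right one, yields invariant states and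
   a test sequence for (v). *)
have [F2 [F2l F2r]] := two_sided_folner (R := R) G_countable G_amenable.
have from_i : uniquely_ergodic Theta -> exists phi : A -> R[i], state phi /\
    forall F, right_Folner R F ->
    forall x, norm_converges (fun k => Avg Theta (F k) x) (phi x)%:A.
  move=> [phi uniq]; exists phi; split.
    have : invariant_states Theta phi by rewrite uniq.
    by case.
  by move=> F FF x; exact: uniquely_ergodic_norm_converges.
tfae.
- move=> /from_i[phi [[phiL _ _] conv]].
  by exists F2, phi; split=> // x; exact: conv.
- move=> [F [phi [Fl phiL conv]]]; exists F, phi; split=> // x.
  exact: norm_weakly_converges.
- move=> [F [phi [[F0 _] phiL conv]]]; apply: from_i.
  (* This gives existence of an invariant state; uniqueness comes from the weak limits, which make
     every invariant state equal to [phi]. *)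
  have [psi [ipsi _]] := invariant_state_asymptotic_max Theta F2r 0.
  have uniq psi' : invariant_states Theta psi' -> psi' = phi.
    move=> ipsi'; apply/funext => x.
    exact: weakly_converges_invariant_state (conv x) ipsi'.
  exists phi; apply/seteqP; split=> [psi' /uniq//|_ ->].
  by rewrite -(uniq _ ipsi).
- move=> [phi [ps conv]]; exists phi; split=> // F FF x.
  exact/norm_weakly_converges/conv.
- move=> [phi [ps conv]]; exists phi.
  have F0 k : F2 k != fset0 by case: F2r.
  apply/seteqP; split=> [psi ipsi|_ ->] /=.
    apply/funext => x.
    exact: weakly_converges_invariant_state F0 _ _ _ (conv _ F2r x) ipsi.
  (* Invariance of [phi]: evaluated at [phi] itself, the averages of [Theta g x] and of [x] tend to
     [phi (Theta g x)] and [phi x], while their difference tends to 0. *)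
  split=> // g; apply/funext => x /=.
  have /(_ phi ps) c0 := norm_weakly_converges (Avg_action_converges Theta F2r g x).
  have := conv _ F2r (Theta g x) phi ps; rewrite (state_scalar ps) => c1.
  have := conv _ F2r x phi ps; rewrite (state_scalar ps) => c2.
  have c3 := cvgB c1 c2.
  have E : (fun k => phi (Avg Theta (F2 k) (Theta g x) - Avg Theta (F2 k) x)) =
      (fun k => phi (Avg Theta (F2 k) (Theta g x)) - phi (Avg Theta (F2 k) x)).
    by apply/funext => k; rewrite (stateB ps).
  rewrite E (state0 ps) in c0.
  by apply/eqP; rewrite -subr_eq0; apply/eqP; exact: (cvg_unique _ (c3 _) c0).
Qed.
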